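(* Let $M\subset\mathbb R^4$ be a generic embedding of a smooth closed surface, let $\lambda\in\mathbb R\setminus\{0,1\}$, and let $(a,b)$ be a weakly parallel pair on $M$. (i) Let $(a,b)$ be a $1$-parallel pair, so that $(G(a),G(b))\in W_{reg}$. If the germ $\Psi_\lambda|_{M\times M}:(\mathbb R^2\times\mathbb R^2,(a,b))\to(\mathbb R^4,\lambda a+(1-\lambda)b)$ has a stable singularity (of type $A_k$, $k=1,2,3,4$), then $G(M)\times G(M)$ is transverse to $W_{reg}$ at $(G(a),G(b))$. (ii) Let $(a,b)$ be a $2$-parallel pair, so that $(G(a),G(b))\in Sing(W)$. If the germ $\Psi_\lambda|_{M\times M}:(\mathbb R^2\times\mathbb R^2,(a,b))\to(\mathbb R^4,\lambda a+(1-\lambda)b)$ has a stable singularity (of type $C_{2,2}^{\pm}$), then $(a,b)$ is a transversal double point of the Gauss map.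
   Context: $\Psi_\lambda(x,y)=\lambda x+(1-\lambda)y$ on $\mathbb R^4\times\mathbb R^4$. Generic embedding: one belonging to a residual set $\mathcal S$ of embeddings (whose existence is a known theorem) for which $\Psi_\lambda|_{M\times M}$ off the diagonal is locally stable, i.e. all its germs are stable. A pair $a\neq b$ in $M$ is weakly parallel if $T_aM$ and $T_bM$, translated to a common point, do not span $\mathbb R^4$; it is $k$-parallel ($k=1,2$) if their intersection has dimension $k$. The possible stable singularities of $\Psi_\lambda|_{M\times M}$, up to smooth changes of coordinates in source and target, are: $A_k$ ($1\le k\le4$): $(u_1,u_2,u_3,y^{k+1}+\sum_{i=1}^{k-1}u_iy^i)$; $C_{2,2}^+$: $(u_1,u_2,x^2+u_1y,y^2+u_2x)$; $C_{2,2}^-$: $(u_1,u_2,x^2-y^2,xy+u_1x+u_2y)$. $Gr(2,4)$ is the Grassmannian of $2$-planes in $\mathbb R^4$, realized as classes $[\pi]$ of nonzero decomposable bivectors in $\mathbb P(\Lambda^2\mathbb R^4)$. The Gauss map is $G:M\to Gr(2,4)$, $a\mapsto[T_aM]$. $W=\{([\pi_1],[\pi_2])\in Gr(2,4)\times Gr(2,4)\ |\ \pi_1\wedge\pi_2=0\}$, a $7$-dimensional variety; $W_{reg}$ is its set of smooth points and $Sing(W)$ its set of singular points, which is the diagonal. Transversality of $G(M)\times G(M)$ at $(G(a),G(b))$ refers to the branch given by the image of the germ of $G\times G$ at $(a,b)$. $(a,b)$, $a\ne b$, is a transversal double point of $G$ if $G(a)=G(b)$ and the two (immersed) branches of $G(M)$,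 images of neighbourhoods of $a$ and $b$, meet transversally in $Gr(2,4)$ there. *)

(* Defs.v *)
From HB Require Import structures.
From mathcomp Require Import all_boot all_order all_algebra.
From mathcomp Require Import all_classical all_reals all_analysis.
Set Implicit Arguments.
Unset Strict Implicit.
Unset Printing Implicit Defensive.
Import Order.TTheory GRing.Theory Num.Theory.
Import numFieldNormedType.Exports.
Local Open Scope classical_set_scope.
Local Open Scope ring_scope.

(** * Smooth maps and map germs *)

Section Smooth.
Context {R : realType}.
Implicit Types E F : normedModType R.

(* [iterD [:: v1; ...; vn] h] is the iterated directional derivative
   D_v1 (... (D_vn h)). *)
Definition iterD E F (vs : seq E) (h : E -> F) : E -> F :=
  foldr (fun v g => 'D_v g) h vs.

(* C^oo on an open set [A] of a finite-dimensional space: all iterated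
   directional derivatives exist and are differentiable on [A]. *)
Definition smooth_on E F (A : set E) (h : E -> F) : Prop :=
  forall (vs : seq E) (x : E), A x -> differentiable (iterD vs h) x.

Definition smooth_at E F (h : E -> F) (p : E) : Prop :=
  exists U : set E, [/\ open U, U p & smooth_on U h].

Definition diffeo_germ E F (h : E -> F) (p : E) : Prop :=
  exists h' : F -> E,
    [/\ smooth_at h p, smooth_at h' (h p),
        \forall x \near p, h' (h x) = x &
        \forall y \near h p, h (h' y) = y].

(* Equivalence of the germs (f, p) and (g, q) under smooth changes of
   coordinates in source and target. *)
Definition A_equiv E F E' F' (f : E -> F) (p : E) (g : E' -> F') (q : E') :
    Prop :=
  exists (h : E -> E') (k : F -> F'),
    [/\ diffeo_germ h p, h p = q,
        diffeo_germ k (f p), k (f p) = g q &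
        \forall x \near p, k (f x) = g (h x)].

(* All derivatives of order at most [r] of [f] and [g] are [e]-close on [K]
   (the derivatives being compared as multilinear forms). *)
Definition Cclose E F (r : nat) (e : R) (K : set E) (f g : E -> F) : Prop :=
  forall (vs : seq E) (x : E),
    (size vs <= r)%N -> (forall v, v \in vs -> `|v| <= 1) -> K x ->
    `|iterD vs f x - iterD vs g x| < e.

(* Stability of the germ of [f] at [p]: on every neighbourhood [V] of [p] where
   [f] is smooth, every smooth map close enough to [f] in the C^oo topology has
   at some point of [V] a germ equivalent to the germ of [f] at [p]. *)
Definition stable_germ E F (f : E -> F) (p : E) : Prop :=
  smooth_at f p /\
  forall V : set E, open V -> V p -> smooth_on V f ->
    exists (K : set E) (r : nat) (e : R),
      [/\ compact K, K `<=` V, 0 < e &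
          forall g : E -> F, smooth_on V g -> Cclose r e K f g ->
            exists2 q, V q & A_equiv f p g q].

(* [X] is, near [p], a smooth submanifold of codimension [c]. *)
Definition submanifold_at E (c : nat) (X : set E) (p : E) : Prop :=
  exists h : E -> 'rV[R]_c,
    [/\ smooth_at h p, range ('d h p) = setT &
        \forall x \near p, X x <-> h x = 0].

(* [v] is the velocity at [p] of a smooth curve contained in [X]. *)
Definition tangent_vector E (X : set E) (p v : E) : Prop :=
  exists c : R -> E,
    [/\ smooth_at c 0, c 0 = p, (\forall t \near (0 : R), X (c t)) &
        derive1 c 0 = v].

(* The germ of [h] at [p] is transverse to [X] inside [Y]. *)
Definition transverse_in E F (h : E -> F) (p : E) (X Y : set F) : Prop :=
  forall v, tangent_vector Y (h p) v ->
    exists w u, tangent_vector X (h p) u /\ v = 'd h p w + u.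

End Smooth.

(** * Closed surfaces and their embeddings *)

(* A smooth compact surface without boundary, not necessarily connected. Its
   atlas consists of one local parametrization [par a : pdom a -> M] centred at
   each point [a], with inverse [coord a]. *)
Record closedSurface (R : realType) := ClosedSurface {
  carrier :> topologicalType;
  surface_compact : compact [set: carrier];
  surface_hausdorff : hausdorff_space carrier;
  pdom : carrier -> set 'rV[R]_2;
  par : carrier -> 'rV[R]_2 -> carrier;
  coord : carrier -> carrier -> 'rV[R]_2;
  pdom_open : forall a, open (pdom a);
  pdom0 : forall a, pdom a 0;
  par0 : forall a, par a 0 = a;
  parK : forall a x, pdom a x -> coord a (par a x) = x;
  par_open : forall a, open (par a @` pdom a);
  par_continuous : forall a x, pdom a x -> {for x, continuous (par a)};
  coord_continuous : forall a q, (par a @` pdom a) q ->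
    {for q, continuous (coord a)};
  transition_smooth : forall a b,
    smooth_on (pdom a `&` par a @^-1` (par b @` pdom b)) (coord b \o par a)
}.

Section Surface.
Context {R : realType} {M : closedSurface R}.
Implicit Types (f g : M -> 'rV[R]_4) (a b : M).

(* The tangent plane T_aM is the row space of this matrix, whose rows are the
   partial derivatives at a of the local parametrization of f(M). *)
Definition tangent_plane f a : 'M[R]_(2, 4) := 'J (f \o par a) 0.

Definition embedding f : Prop :=
  [/\ forall a, smooth_on (pdom a) (f \o par a),
      forall a, row_free (tangent_plane f a),
      injective f &
      forall U : set M, open U -> exists2 V, open V & U = f @^-1` V].

(* Basic neighbourhoods of [f] in the C^oo topology on maps M -> R^4. *)
Definition Cinf_nbhs f (N : set (M -> 'rV[R]_4)) : Prop :=
  exists (l : seq M) (K : M -> set 'rV[R]_2) (r : nat) (e : R),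
    [/\ 0 < e, forall a, a \in l -> compact (K a) /\ K a `<=` pdom a &
        forall g, (forall a, a \in l ->
          Cclose r e (K a) (f \o par a) (g \o par a)) -> N g].

Definition open_in_embeddings (O : set (M -> 'rV[R]_4)) : Prop :=
  O `<=` embedding /\
  forall f, O f -> exists2 N, Cinf_nbhs f N & N `&` embedding `<=` O.

Definition dense_in_embeddings (O : set (M -> 'rV[R]_4)) : Prop :=
  forall f N, embedding f -> Cinf_nbhs f N -> O `&` N !=set0.

Definition residual (S : set (M -> 'rV[R]_4)) : Prop :=
  S `<=` embedding /\
  exists O : nat -> set (M -> 'rV[R]_4),
    (forall n, open_in_embeddings (O n) /\ dense_in_embeddings (O n)) /\
    embedding `&` \bigcap_n O n `<=` S.

Definition Psi (lam : R) (x y : 'rV[R]_4) : 'rV[R]_4 :=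
  lam *: x + (1 - lam) *: y.

(* Psi_lam restricted to M x M, in the local coordinates centred at (a, b). *)
Definition Psi_local f (lam : R) a b (w : 'rV[R]_2 * 'rV[R]_2) : 'rV[R]_4 :=
  Psi lam (f (par a w.1)) (f (par b w.2)).

Definition locally_stable f (lam : R) : Prop :=
  forall a b, a <> b -> stable_germ (Psi_local f lam a b) (0, 0).

Definition generic_embedding (lam : R) f : Prop :=
  exists S : set (M -> 'rV[R]_4),
    [/\ residual S, forall g, S g -> locally_stable g lam & S f].

Definition weakly_parallel f a b : Prop :=
  a <> b /\ ~~ row_full (tangent_plane f a + tangent_plane f b)%MS.

Definition k_parallel (k : nat) f a b : Prop :=
  weakly_parallel f a b /\
  \rank (tangent_plane f a :&: tangent_plane f b)%MS = k.

End Surface.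

(** * Normal forms *)

Section NormalForms.
Context {R : realType}.

Definition row_of_seq (n : nat) (s : seq R) : 'rV[R]_n := \row_(i < n) s`_i.

(* (u1, u2, u3, y) |->
   (u1, u2, u3, y^(k+1) + sum_(1 <= i <= k-1) u_i y^i), meant for k <= 4 *)
Definition normal_A (k : nat) (z : 'rV[R]_4) : 'rV[R]_4 :=
  let u (i : nat) := z 0 (inord i.-1) in
  let y := z 0 (inord 3) in
  row_of_seq 4 [:: u 1%N; u 2%N; u 3%N; y ^+ k.+1 + \sum_(1 <= i < k) u i * y ^+ i].

Definition normal_C22p (z : 'rV[R]_4) : 'rV[R]_4 :=
  let u1 := z 0 (inord 0) in let u2 := z 0 (inord 1) in
  let x := z 0 (inord 2) in let y := z 0 (inord 3) in
  row_of_seq 4 [:: u1; u2; x ^+ 2 + u1 * y; y ^+ 2 + u2 * x].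

Definition normal_C22m (z : 'rV[R]_4) : 'rV[R]_4 :=
  let u1 := z 0 (inord 0) in let u2 := z 0 (inord 1) in
  let x := z 0 (inord 2) in let y := z 0 (inord 3) in
  row_of_seq 4 [:: u1; u2; x ^+ 2 - y ^+ 2; x * y + u1 * x + u2 * y].

Definition stable_singularity_A (h : 'rV[R]_2 * 'rV[R]_2 -> 'rV[R]_4) p :
    Prop :=
  stable_germ h p /\
  exists2 k : nat, (1 <= k <= 4)%N & A_equiv h p (normal_A k) 0.

Definition stable_singularity_C22 (h : 'rV[R]_2 * 'rV[R]_2 -> 'rV[R]_4) p :
    Prop :=
  stable_germ h p /\
  (A_equiv h p normal_C22p 0 \/ A_equiv h p normal_C22m 0).

End NormalForms.

(** * The Grassmannian Gr(2,4) and the variety W *)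

Section Grassmannian.
Context {R : realType}.
Implicit Types (u v : 'rV[R]_4) (p q : 'rV[R]_6) (k l : 'I_6).

(* Bivectors are given by their coordinates in the basis
   e12, e13, e14, e23, e24, e34 of Lambda^2 R^4. *)
Definition wedge u v : 'rV[R]_6 :=
  let m (i j : nat) :=
    u 0 (inord i) * v 0 (inord j) - u 0 (inord j) * v 0 (inord i) in
  row_of_seq 6 [:: m 0%N 1%N; m 0%N 2%N; m 0%N 3%N;
                   m 1%N 2%N; m 1%N 3%N; m 2%N 3%N].

(* The coefficient of p /\ q on e1234. *)
Definition wedge2 p q : R :=
  let p_ (i : nat) := p 0 (inord i) in let q_ (i : nat) := q 0 (inord i) in
  p_ 0%N * q_ 5%N - p_ 1%N * q_ 4%N + p_ 2%N * q_ 3%N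
  + p_ 3%N * q_ 2%N - p_ 4%N * q_ 1%N + p_ 5%N * q_ 0%N.

Definition decomposable p : Prop := exists u v, p = wedge u v.

(* The point of P(Lambda^2 R^4) defined by a nonzero bivector [p], as the set of
   its representatives. *)
Definition pclass p : set 'rV[R]_6 := [set c *: p | c in [set c : R | c != 0]].

Definition Gr24 : set (set 'rV[R]_6) :=
  [set pclass p | p in [set p | p != 0 /\ decomposable p]].

Definition W : set (set 'rV[R]_6 * set 'rV[R]_6) :=
  [set P | exists p q : 'rV[R]_6,
    [/\ p != 0 /\ decomposable p, q != 0 /\ decomposable q,
        P = (pclass p, pclass q) & wedge2 p q = 0]].

(* The affine chart of P(Lambda^2 R^4) on which the k-th homogeneous coordinate
   does not vanish: a point is sent to its representative with k-th coordinate
   equal to 1, in the affine hyperplane of R^6 defined by this equation. *)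
Definition chart_dom k : set (set 'rV[R]_6) :=
  [set pclass p | p in [set p : 'rV[R]_6 | p 0 k != 0]].
Definition chart k (C : set 'rV[R]_6) : 'rV[R]_6 :=
  xget 0 [set p : 'rV[R]_6 | C p /\ p 0 k = 1].
Definition in_chart k (X : set (set 'rV[R]_6)) : set 'rV[R]_6 :=
  chart k @` (X `&` chart_dom k).

Definition chart2_dom k l : set (set 'rV[R]_6 * set 'rV[R]_6) :=
  chart_dom k `*` chart_dom l.
Definition chart2 k l (P : set 'rV[R]_6 * set 'rV[R]_6) :
    'rV[R]_6 * 'rV[R]_6 :=
  (chart k P.1, chart l P.2).
Definition in_chart2 k l (X : set (set 'rV[R]_6 * set 'rV[R]_6)) :
    set ('rV[R]_6 * 'rV[R]_6) :=
  chart2 k l @` (X `&` chart2_dom k l).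

(* Points near which W is a smooth submanifold of dimension 7; the charts take
   values in the 12-dimensional space R^6 x R^6. *)
Definition W_reg : set (set 'rV[R]_6 * set 'rV[R]_6) :=
  [set P | W P /\ exists k l, chart2_dom k l P /\
    submanifold_at (12 - 7) (in_chart2 k l W) (chart2 k l P)].

Definition W_sing : set (set 'rV[R]_6 * set 'rV[R]_6) := W `\` W_reg.

End Grassmannian.

Section GaussMap.
Context {R : realType} {M : closedSurface R}.
Implicit Types (f : M -> 'rV[R]_4) (a b : M).

Definition Gauss f a : set 'rV[R]_6 :=
  pclass (wedge (row 0 (tangent_plane f a)) (row 1 (tangent_plane f a))).

Definition Gauss_local f a (x : 'rV[R]_2) : set 'rV[R]_6 := Gauss f (par a x).

Definition Gauss2_local f a b (w : 'rV[R]_2 * 'rV[R]_2) :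
    set 'rV[R]_6 * set 'rV[R]_6 :=
  (Gauss f (par a w.1), Gauss f (par b w.2)).

(* The branch of G(M) x G(M) given by the germ of G x G at (a, b) is transverse
   to W_reg in Gr(2,4) x Gr(2,4). *)
Definition Gauss_transverse_Wreg f a b : Prop :=
  W_reg (Gauss f a, Gauss f b) /\
  exists k l, chart2_dom k l (Gauss f a, Gauss f b) /\
    transverse_in (chart2 k l \o Gauss2_local f a b) (0, 0)
      (in_chart2 k l W_reg) (in_chart2 k l (Gr24 `*` Gr24)).

Definition transversal_double_point f a b : Prop :=
  [/\ a <> b, Gauss f a = Gauss f b &
    exists k, let Ga := chart k \o Gauss_local f a in
              let Gb := chart k \o Gauss_local f b in
      [/\ chart_dom k (Gauss f a),
          injective ('d Ga 0), injective ('d Gb 0) &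
          forall v, tangent_vector (in_chart k Gr24) (chart k (Gauss f a)) v ->
            exists x y, v = 'd Ga 0 x + 'd Gb 0 y]].

End GaussMap.

(* Main.v *)
From HB Require Import structures.
From mathcomp Require Import all_boot all_order all_algebra.
From mathcomp Require Import all_classical all_reals all_analysis.
From mathcomp Require Import ring.
Require Import Defs.
Set Implicit Arguments.
Unset Strict Implicit.
Unset Printing Implicit Defensive.
Import Order.TTheory GRing.Theory Num.Theory.
Import numFieldNormedType.Exports.
Local Open Scope classical_set_scope.
Local Open Scope ring_scope.

(** Why the theorem holds.

    In local coordinates the map is [phi (x, y) = lam X(x) + (1 - lam) Y(y)],
    where X and Y parametrize the surface near a and b.  A smooth map germ phi
    has an intrinsic second derivative: if K and C are the kernel and the
    cokernel of its differential at p, then [(w, k) |-> D_w D_k phi (p)] modulo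
    the image of the differential is a well defined linear map from the source
    to Hom(K, C), and smooth changes of coordinates in source and target
    transport it ([A_equiv_second_kernel]).  Its kernel, [in_second_kernel],
    can be read off the normal forms: it is a proper subspace for A_k
    ([second_kernel_normal_A_proper]) and it is zero for the two C_{2,2} forms
    ([second_kernel_normal_C22p], [second_kernel_normal_C22m]).  That is all
    the theorem takes from the classification.

    On the side of the surface, choose frames of the two tangent planes, e, u
    at a and e, v at b, with a vector e in common (and u = v if the planes
    coincide).  The derivative of [wedge e u] along the surface is
    [wedge e' u + wedge e u'], so the differentials of the two branches of the
    Gauss map are made of the second derivatives of X and Y, and these are
    also the entries of the intrinsic second derivative of phi.

    For a 1-parallel pair, K is spanned by the relation coming from e, and the
    differential of [wedge2 (G a) (G b)] is the volume of [e' - f'] against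
    e, u, v ([wedge2_tangent_pair]), where e' and f' are the derivatives of e
    along the two branches.  If it vanished identically, the intrinsic second
    derivative of phi would vanish, which A_k forbids.  So the Gauss branch
    leaves W to first order, and transversality follows because every vector
    tangent to Gr x Gr that annihilates the incidence form is the velocity of
    an explicit curve of pairs of planes sharing a line ([W_reg_curve]).

    For a 2-parallel pair, a relation [dG_a x + dG_b y = 0] puts (x, -y) in the
    kernel of the intrinsic second derivative, so C_{2,2} forces x = y = 0; as
    2 + 2 is the dimension of the Grassmannian, the two branches are immersed
    and together span its tangent space ([tangent_space_sum]).

    Finally W is cut out of R^6 x R^6 in charts by five equations that are
    independent off the diagonal ([W_reg_pair]), whereas on the diagonal the
    lines contained in W already span a space of dimension 8
    ([diagonal_not_W_reg]), too large for a 7-dimensional manifold. *)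

(** * Directional derivatives and differentials *)

Section Calculus.
Context {R : realType}.
Implicit Types E F G : normedModType R.

(** The Gauss map is known only through a formula valid near the base point, so
    differentiability has to pass between functions with the same germ. *)
Lemma near_eq_differentiable E F (f g : E -> F) (a : E) :
  (\forall x \near a, f x = g x) -> differentiable f a -> differentiable g a.
Proof.
move=> fg df.
have E0 : g \o shift a = cst (g a) + 'd f a +o_ (0 : E) id.
  apply/eqaddoP => e e0; have := diff_locally df => /eqaddoP/(_ e e0).
  have fg0 : \forall z \near (0 : E), f (z + a) = g (z + a).
    by have := fg; rewrite (near_shift 0 a) subr0.
  apply: filter_app; near=> z.
  have fgz : f (z + a) = g (z + a) by near: z.
  by rewrite !fctE /= /cst fgz (nbhs_singleton fg).
have Ed : 'd g a = 'd f a :> (E -> F).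
  by apply: diff_unique E0 => x; exact: diff_continuous.
apply/diff_locallyP; rewrite Ed; split => //.
by move=> x; exact: diff_continuous.
Unshelve. all: by end_near. Qed.

Lemma near_eq_diff E F (f g : E -> F) (a : E) :
  (\forall x \near a, f x = g x) -> differentiable f a -> 'd f a = 'd g a :> (E -> F).
Proof.
move=> fg df; apply/funext => v.
by rewrite -!deriveE//; [exact: near_eq_derive | exact: near_eq_differentiable fg df].
Qed.

Lemma is_derive_diff E F (f : E -> F) (x v : E) :
  differentiable f x -> is_derive x v f ('d f x v).
Proof. by move=> df; apply: DeriveDef; [exact: diff_derivable|exact: deriveE]. Qed.

Lemma is_derive_comp_diff E F G (f : E -> F) (g : F -> G) (x v : E) (df : F):
  differentiable f x -> is_derive x v f df -> differentiable g (f x) ->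
  is_derive x v (g \o f) ('d g (f x) df).
Proof.
move=> dfx [_ <-] dg; rewrite (deriveE _ dfx).
have dgf : differentiable (g \o f) x by exact: differentiable_comp dfx dg.
have -> : 'd g (f x) ('d f x v) = 'd (g \o f) x v by rewrite (diff_comp dfx dg).
exact: is_derive_diff.
Qed.

Lemma is_derive_mxP E m n (f : E -> 'M[R]_(m, n)) (x v : E) (df : 'M[R]_(m, n)) :
  is_derive x v f df <-> forall i j, is_derive x v (fun z => f z i j) (df i j).
Proof.
split.
  move=> [fx <-] i j; apply: DeriveDef; first exact: (derivable_mxP _ _ _).1.
  by rewrite derive_mx// mxE.
move=> H; have fx : derivable f x v by apply/derivable_mxP => i j; case: (H i j).
apply: DeriveDef => //; rewrite derive_mx//; apply/matrixP => i j; rewrite mxE.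
by case: (H i j).
Qed.

Lemma is_derive_rowP E n (f : E -> 'rV[R]_n) (x v : E) (df : 'rV[R]_n) :
  (forall j, is_derive x v (fun z => f z 0 j) (df 0 j)) -> is_derive x v f df.
Proof. by move=> H; apply/is_derive_mxP => i j; rewrite ord1. Qed.

Lemma is_derive_coord E n (f : E -> 'rV[R]_n) (x v : E) (df : 'rV[R]_n) j :
  is_derive x v f df -> is_derive x v (fun z => f z 0 j) (df 0 j).
Proof. by move/is_derive_mxP => /(_ 0 j). Qed.

Lemma differentiable_rowP E n (f : E -> 'rV[R]_n) (x : E) :
  (forall j, differentiable (fun z => f z 0 j) x) -> differentiable f x.
Proof.
move=> H; have -> : f = \sum_(j < n) (fun z => f z 0 j *: delta_mx 0 j).
  apply/funext => z; rewrite fct_sumE; apply/rowP => i.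
  by rewrite summxE {1}[f z]row_sum_delta summxE.
by apply: differentiable_sum => j; apply: differentiableZl.
Qed.

Lemma differentiable_rowcoord E n (f : E -> 'rV[R]_n) (x : E) j :
  differentiable f x -> differentiable (fun z => f z 0 j) x.
Proof. by move=> df; exact: (differentiable_comp df (differentiable_coord _ _ _)). Qed.

Lemma is_derive_scale E n (s : E -> R) (f : E -> 'rV[R]_n) (x v : E) ds df :
  is_derive x v s ds -> is_derive x v f df ->
  is_derive x v (fun z => s z *: f z) (ds *: f x + s x *: df).
Proof.
move=> Hs Hf; apply: is_derive_rowP => j.
have Hj := is_derive_coord j Hf.
have -> : (fun z => (s z *: f z) 0 j) = s * (fun z => f z 0 j).
  by apply/funext => z; rewrite mxE.
apply: is_derive_eq (is_deriveM Hs Hj) _.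
by rewrite !mxE addrC; congr (_ + _); rewrite /GRing.scale /= mulrC.
Qed.

(** * Smooth functions *)

Lemma iterD_rcons E F (vs : seq E) v (h : E -> F) :
  iterD (rcons vs v) h = iterD vs ('D_v h).
Proof. by rewrite /iterD -cats1 foldr_cat. Qed.

Lemma eq_on_derive E F (A : set E) (f g : E -> F) v :
  open A -> {in A, f =1 g} -> {in A, 'D_v f =1 'D_v g}.
Proof.
move=> oA fg x /set_mem Ax; apply: near_eq_derive.
by near=> y; apply: fg; apply/mem_set; near: y; exact: open_nbhs_nbhs.
Unshelve. all: by end_near. Qed.

Lemma eq_on_iterD E F (A : set E) (f g : E -> F) vs :
  open A -> {in A, f =1 g} -> {in A, iterD vs f =1 iterD vs g}.
Proof.
by move=> oA fg; elim: vs => //= v vs IH; exact: eq_on_derive.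
Qed.

Lemma smooth_on_differentiable E F (A : set E) (h : E -> F) x :
  smooth_on A h -> A x -> differentiable h x.
Proof. by move=> /(_ [::]) H Ax; exact: H. Qed.

Lemma smooth_on_derive E F (A : set E) (h : E -> F) v :
  smooth_on A h -> smooth_on A ('D_v h).
Proof. by move=> H vs x Ax; rewrite -iterD_rcons; exact: H. Qed.

(** Smoothness is the largest class of differentiable functions that is stable
    under directional derivatives, which replaces induction on lists of
    directions: it is enough to exhibit a class with these two properties. *)
Lemma smooth_on_coinduction E F (A : set E) (C : (E -> F) -> Prop) :
  open A ->
  (forall h, C h -> forall x, A x -> differentiable h x) ->
  (forall h v, C h -> exists2 h', C h' & {in A, 'D_v h =1 h'}) ->
  forall h, C h -> smooth_on A h.
Proof.
move=> oA Cd CD h Ch vs; elim/last_ind: vs h Ch => [|vs v IH] h Ch x Ax.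
  exact: Cd.
have [h' Ch' hh'] := CD _ v Ch; rewrite iterD_rcons.
apply: (@near_eq_differentiable _ _ (iterD vs h')); last exact: IH.
near=> y; apply/esym/(eq_on_iterD vs oA hh')/mem_set.
by near: y; exact: open_nbhs_nbhs.
Unshelve. all: by end_near. Qed.

Lemma smooth_on_comp_lin E F G (A : set E) (L : {linear F -> G}) (h : E -> F) :
  open A -> continuous L -> smooth_on A h -> smooth_on A (L \o h).
Proof.
move=> oA cL sh.
apply: (@smooth_on_coinduction _ _ _ (fun g => exists2 h0, smooth_on A h0 & g = L \o h0)) => //.
- move=> g [h0 sh0 ->] x Ax.
  apply: differentiable_comp (linear_differentiable _ cL).
  exact: smooth_on_differentiable sh0 Ax.
- move=> g v [h0 sh0 ->]; exists (L \o 'D_v h0).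
    by exists ('D_v h0) => //; exact: smooth_on_derive.
  move=> x /set_mem Ax; have d0 := smooth_on_differentiable sh0 Ax.
  have [_ ->] := is_derive_comp_diff d0 (is_derive_diff v d0) (linear_differentiable (h0 x) cL).
  by rewrite (diff_lin (h0 x) cL) /= deriveE.
- by exists h.
Qed.

Lemma smooth_onD E F (A : set E) (f g : E -> F) :
  open A -> smooth_on A f -> smooth_on A g -> smooth_on A (f + g).
Proof.
move=> oA sf sg.
apply: (@smooth_on_coinduction _ _ _ (fun h => exists f0 g0,
  [/\ smooth_on A f0, smooth_on A g0 & h = f0 + g0])) => //.
- move=> h [f0 [g0 [sf0 sg0 ->]]] x Ax.
  by apply: differentiableD;
    [exact: smooth_on_differentiable sf0 Ax | exact: smooth_on_differentiable sg0 Ax].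
- move=> h v [f0 [g0 [sf0 sg0 ->]]]; exists ('D_v f0 + 'D_v g0).
    exists ('D_v f0), ('D_v g0); split => //; exact: smooth_on_derive.
  move=> x /set_mem Ax; rewrite deriveD//; apply: diff_derivable.
    exact: smooth_on_differentiable sf0 Ax.
  exact: smooth_on_differentiable sg0 Ax.
- by exists f, g.
Qed.

Lemma smooth_on_lin E F (A : set E) (L : {linear E -> F}) :
  open A -> continuous L -> smooth_on A L.
Proof.
move=> oA cL.
apply: (@smooth_on_coinduction _ _ _ (fun g => g = L :> (_ -> _) \/ exists c, g = cst c)) => //.
- move=> g [->|[c ->]] x _; [exact: linear_differentiable|exact: differentiable_cst].
- move=> g v [->|[c ->]].
    exists (cst (L v)); first by right; exists (L v).
    by move=> x _; rewrite deriveE ?diff_lin//; exact: linear_differentiable.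
  by exists (cst 0) => [|x _]; [right; exists 0 | rewrite derive_cst].
- by left.
Qed.

Lemma smooth_on_cst E F (A : set E) (c : F) : open A -> smooth_on A (cst c).
Proof.
move=> oA.
apply: (@smooth_on_coinduction _ _ _ (fun g => exists c, g = cst c)) => //.
- by move=> g [? ->] x _; exact: differentiable_cst.
- move=> g v [? ->]; exists (cst 0) => [|x _]; [by exists 0 | by rewrite derive_cst].
- by exists c.
Qed.

(** Leibniz' rule does not map products to products, but it does map this class
    into itself, so that [smooth_on_coinduction] applies to it. *)
Inductive ring_generated E (A : set E) : (E -> R) -> Prop :=
| rg_smooth f : smooth_on A f -> ring_generated A f
| rg_add f g : ring_generated A f -> ring_generated A g -> ring_generated A (f + g)
| rg_mul f g : ring_generated A f -> ring_generated A g -> ring_generated A (f * g)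
| rg_inv f : (forall x, A x -> f x != 0) -> ring_generated A f ->
    ring_generated A (fun x => (f x)^-1).

Lemma ring_generated_smooth E (A : set E) (f : E -> R) :
  open A -> ring_generated A f -> smooth_on A f.
Proof.
move=> oA; apply: smooth_on_coinduction => // {f}.
  move=> h; elim => {h} [f sf|f g _ df _ dg|f g _ df _ dg|f f0 _ df] x Ax.
  - exact: smooth_on_differentiable sf Ax.
  - by apply: differentiableD; [exact: df|exact: dg].
  - by apply: differentiableM; [exact: df|exact: dg].
  - by apply: differentiableV; [exact: df|exact: f0].
move=> h v Ch.
suff [h' Ch' Hh'] : exists2 h', ring_generated A h' & forall x, A x -> is_derive x v h (h' x).
  by exists h' => // x /set_mem Ax; case: (Hh' x Ax).
elim: Ch => {h} [f sf|f g Cf [f' Cf' Hf] Cg [g' Cg' Hg]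
  |f g Cf [f' Cf' Hf] Cg [g' Cg' Hg]|f f0 Cf [f' Cf' Hf]].
- exists ('D_v f); first exact/rg_smooth/smooth_on_derive.
  move=> x Ax; apply: derivableP; apply: diff_derivable.
  exact: smooth_on_differentiable sf Ax.
- exists (f' + g'); first exact: rg_add.
  by move=> x Ax; apply: is_deriveD; [exact: Hf|exact: Hg].
- exists (f * g' + g * f'); first by apply: rg_add; exact: rg_mul.
  by move=> x Ax; apply: is_deriveM; [exact: Hf|exact: Hg].
- pose fi x := (f x)^-1.
  exists (cst (-1) * (fi * fi) * f').
    apply: rg_mul => //; apply: rg_mul; first exact/rg_smooth/smooth_on_cst.
    by apply: rg_mul; exact: rg_inv.
  move=> x Ax; have [dfx f'E] := Hf x Ax.
  apply: DeriveDef; first by apply: derivableV => //; exact: f0.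
  rewrite deriveV //; last exact: f0.
  by rewrite f'E /GRing.scale /= /fi !fctE /cst -exprVn expr2 mulN1r.
Qed.

Lemma smooth_onM E (A : set E) (f g : E -> R) :
  open A -> smooth_on A f -> smooth_on A g -> smooth_on A (f * g).
Proof.
move=> oA sf sg; apply: ring_generated_smooth => //.
by apply: rg_mul; exact: rg_smooth.
Qed.

Lemma smooth_onV E (A : set E) (f : E -> R) :
  open A -> (forall x, A x -> f x != 0) -> smooth_on A f ->
  smooth_on A (fun x => (f x)^-1).
Proof.
by move=> oA f0 sf; apply: ring_generated_smooth => //; apply: rg_inv => //; exact: rg_smooth.
Qed.

Lemma smooth_on_scale E F (A : set E) (s : E -> R) (c : F) :
  open A -> smooth_on A s -> smooth_on A (fun x => s x *: c).
Proof.
move=> oA ss.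
have lin_c : linear ( *:%R ^~ c : R -> F).
  by move=> u y z; rewrite scalerDl scalerA.
pose M := GRing.isLinear.Build _ _ _ _ _ lin_c.
pose L : {linear R -> F} := HB.pack ( *:%R ^~ c) M.
rewrite -[fun x => _]/(L \o s).
by apply: smooth_on_comp_lin => //; exact: scalel_continuous.
Qed.

End Calculus.

(** * The intrinsic second derivative *)

Section IntrinsicSecondDerivative.
Context {R : realType}.
Implicit Types E : normedModType R.

Lemma smooth_at_near E (F : normedModType R) (h : E -> F) p vs :
  smooth_at h p -> \forall x \near p, differentiable (iterD vs h) x.
Proof.
move=> [U [oU Up sU]]; near=> x; apply: sU.
by near: x; exact: open_nbhs_nbhs.
Unshelve. all: by end_near. Qed.

Lemma smooth_at_differentiable E (F : normedModType R) (h : E -> F) p vs :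
  smooth_at h p -> differentiable (iterD vs h) p.
Proof. by move=> /(smooth_at_near vs)/nbhs_singleton. Qed.

Lemma diff_row_sum n m (g : 'rV[R]_n -> 'rV[R]_m) q (c : 'rV[R]_n) :
  'd g q c = \sum_j c 0 j *: 'd g q (delta_mx 0 j).
Proof.
by rewrite {1}[c]row_sum_delta linear_sum; apply: eq_bigr => j _; rewrite linearZ.
Qed.

Lemma derive_row_sum n m (g : 'rV[R]_n -> 'rV[R]_m) q (c : 'rV[R]_n) :
  differentiable g q ->
  'D_c g q = \sum_j c 0 j *: 'D_(delta_mx 0 j) g q.
Proof.
move=> dg; rewrite deriveE// diff_row_sum.
by apply: eq_bigr => j _; rewrite deriveE.
Qed.

Lemma is_derive_sum_pointwise E m n (h : 'I_n -> E -> 'rV[R]_m) (dh : 'I_n -> 'rV[R]_m) (x v : E) :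
  (forall i, is_derive x v (h i) (dh i)) ->
  is_derive x v (fun z => \sum_i h i z) (\sum_i dh i).
Proof.
move=> H; have -> : (fun z => \sum_i h i z) = \sum_i h i.
  by apply/funext => z; rewrite fct_sumE.
exact: is_derive_sum.
Qed.

(** The second term involves [phi] only through its first derivative; it
    vanishes whenever k is in the kernel of the differential of phi. *)
Lemma derive2_comp E n m (phi : E -> 'rV[R]_n) (g : 'rV[R]_n -> 'rV[R]_m) p w k :
  smooth_at phi p -> smooth_at g (phi p) ->
  'D_w ('D_k (g \o phi)) p =
    'd g (phi p) ('D_w ('D_k phi) p) +
    'D_('d phi p w) ('D_('D_k phi p) g) (phi p).
Proof.
move=> sphi sg.
have dphi : differentiable phi p := smooth_at_differentiable [::] sphi.
have dDphi : differentiable ('D_k phi) p := smooth_at_differentiable [:: k] sphi.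
have cphi : {for p, continuous phi} := differentiable_continuous dphi.
have near_dg : \forall z \near p, differentiable g (phi z).
  exact: (cphi _ (smooth_at_near [::] sg)).
have near_comp : \forall z \near p,
    'D_k (g \o phi) z = \sum_j ('D_k phi z) 0 j *: 'D_(delta_mx 0 j) g (phi z).
  near=> z.
  have dz : differentiable phi z.
    by near: z; exact: (smooth_at_near [::] sphi).
  have dgz : differentiable g (phi z) by near: z.
  rewrite deriveE; last exact: differentiable_comp dz dgz.
  by rewrite (diff_comp dz dgz) /= -(deriveE k dz) -(deriveE _ dgz) derive_row_sum.
rewrite (near_eq_derive _ near_comp).
have near_g : \forall y \near phi p,
    'D_('D_k phi p) g y = \sum_j ('D_k phi p) 0 j *: 'D_(delta_mx 0 j) g y.
  near=> y; apply: derive_row_sum; near: y; exact: (smooth_at_near [::] sg).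
rewrite (near_eq_derive _ near_g).
have Dg j : differentiable ('D_(delta_mx 0 j) g) (phi p) :=
  smooth_at_differentiable [:: delta_mx 0 j] sg.
have -> : 'D_('d phi p w) (fun y => \sum_j ('D_k phi p) 0 j *: 'D_(delta_mx 0 j) g y) (phi p) =
   \sum_j ('D_k phi p) 0 j *: 'd ('D_(delta_mx 0 j) g) (phi p) ('d phi p w).
  have H : forall j, is_derive (phi p) ('d phi p w)
     (fun y => ('D_k phi p) 0 j *: 'D_(delta_mx 0 j) g y)
     (('D_k phi p) 0 j *: 'd ('D_(delta_mx 0 j) g) (phi p) ('d phi p w)).
    by move=> j; apply: is_deriveZ; exact: is_derive_diff.
  by have [_ ->] := is_derive_sum_pointwise H.
have H : forall j, is_derive p w (fun z => ('D_k phi z) 0 j *: 'D_(delta_mx 0 j) g (phi z))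
    (('D_w ('D_k phi) p) 0 j *: 'D_(delta_mx 0 j) g (phi p) +
     ('D_k phi p) 0 j *: 'd ('D_(delta_mx 0 j) g) (phi p) ('d phi p w)).
  move=> j; apply: is_derive_scale.
    by apply: is_derive_coord; apply: derivableP; exact: diff_derivable.
  exact: (is_derive_comp_diff dphi (is_derive_diff w dphi) (Dg j)).
have [_ ->] := is_derive_sum_pointwise H.
rewrite big_split /=; congr (_ + _).
rewrite diff_row_sum; apply: eq_bigr => j _.
by rewrite (deriveE _ (smooth_at_differentiable [::] sg)).
Unshelve. all: by end_near. Qed.

(** The vectors w killed by the intrinsic second derivative of [phi] at [p]: for
    k in the kernel of the differential, D_w D_k phi (p) vanishes in its
    cokernel. *)
Definition in_second_kernel E m (phi : E -> 'rV[R]_m) (p w : E) : Prop :=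
  forall k, 'D_k phi p = 0 -> exists xi, 'D_w ('D_k phi) p = 'D_xi phi p.

Lemma diffeo_germ_diffK E (F : normedModType R) (h : E -> F) (p : E) : diffeo_germ h p ->
  exists L : F -> E, [/\ cancel ('d h p) L & cancel L ('d h p)].
Proof.
move=> [h' [sh sh' hK h'K]].
have dh : differentiable h p := smooth_at_differentiable [::] sh.
have dh' : differentiable h' (h p) := smooth_at_differentiable [::] sh'.
have hp : h' (h p) = p := nbhs_singleton hK.
have dh2 : differentiable h (h' (h p)) by rewrite hp.
exists ('d h' (h p)); split => v.
  have := diff_comp dh dh' => /(congr1 (fun f => f v)) /= <-.
  rewrite -(@near_eq_diff _ _ _ id) ?diff_val//.
  by apply: filterS hK => x /= ->.
have := diff_comp dh' dh2 => /(congr1 (fun f => f v)) /=.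
rewrite hp => <-.
rewrite -(@near_eq_diff _ _ _ id) ?diff_val//.
by apply: filterS h'K => x /= ->.
Qed.

(** Differentiate [k \o f = g \o h] twice, first along a kernel vector.  On the
    left the Hessian of the target change k is applied to a zero vector; on the
    right the second derivative of the source change h is mapped into the image
    of the differential of g.  Both corrections disappear in the cokernel, and
    the differential of h carries one kernel onto the other. *)
Lemma A_equiv_second_kernel E n m (f : E -> 'rV[R]_m) p (g : 'rV[R]_n -> 'rV[R]_m) q :
  smooth_at f p -> smooth_at g q -> A_equiv f p g q ->
  exists L : E -> 'rV[R]_n, [/\ bijective L, L 0 = 0 &
    forall w, in_second_kernel f p w -> in_second_kernel g q (L w)].
Proof.
move=> sf sg [h [k [hD hp kD kf kfgh]]].
have [Lh [hL Lh_h]] := diffeo_germ_diffK hD.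
have [Lk [kL Lk_k]] := diffeo_germ_diffK kD.
exists ('d h p); split; [by exists Lh|by rewrite linear0|].
have [_ [sh _ _ _]] := hD; have [_ [sk _ _ _]] := kD.
have dh : differentiable h p := smooth_at_differentiable [::] sh.
have dk : differentiable k (f p) := smooth_at_differentiable [::] sk.
have df : differentiable f p := smooth_at_differentiable [::] sf.
have dg : differentiable g q := smooth_at_differentiable [::] sg.
have dgh : differentiable g (h p) by rewrite hp.
have d1 v : 'd k (f p) ('d f p v) = 'd g q ('d h p v).
  transitivity ('d (k \o f) p v).
    exact: (esym (congr1 (fun F => F v) (diff_comp df dk))).
  transitivity ('d (g \o h) p v).
    exact: (congr1 (fun F => F v) (near_eq_diff kfgh (differentiable_comp df dk))).
  by rewrite -hp; exact: (congr1 (fun F => F v) (diff_comp dh dgh)).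
move=> w fw k' gk'.
pose kap := Lh k'.
have hkap : 'd h p kap = k' by rewrite /kap Lh_h.
have fkap : 'D_kap f p = 0.
  rewrite deriveE//; apply: (can_inj kL).
  by rewrite d1 hkap -(deriveE _ dg) gk' linear0.
have [xi fxi] := fw _ fkap.
have sgh : smooth_at g (h p) by rewrite hp.
have E2 : 'D_w ('D_kap (k \o f)) p = 'D_w ('D_kap (g \o h)) p.
  apply: near_eq_derive.
  by apply: filterS (nbhs_interior kfgh) => x; exact: near_eq_derive.
move: E2; rewrite (derive2_comp _ _ sf sk) (derive2_comp _ _ sh sgh) hp fkap.
rewrite fxi (deriveE _ df) d1 (deriveE _ dh) hkap.
have -> : 'D_0 k = cst 0 by apply/funext => y; rewrite derive0.
rewrite derive_cst addr0 => /eqP; rewrite addrC -subr_eq => /eqP <-.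
by exists ('d h p xi - 'D_w ('D_kap h) p); rewrite (deriveE _ dg) linearB.
Unshelve. all: by end_near. Qed.

End IntrinsicSecondDerivative.

(** * Smoothness and derivatives in coordinates *)

Section SmoothCoordinates.
Context {R : realType}.
Implicit Types E : normedModType R.

Lemma smooth_on_coord E n (A : set E) (f : E -> 'rV[R]_n) j :
  open A -> smooth_on A f -> smooth_on A (fun z => f z 0 j).
Proof.
move=> oA sf.
have lin_j : linear (fun N : 'rV[R]_n => N 0 j : R) by move=> u y z; rewrite !mxE.
pose M := GRing.isLinear.Build _ _ _ _ _ lin_j.
pose L : {linear 'rV[R]_n -> R} := HB.pack (fun N : 'rV[R]_n => N 0 j : R) M.
rewrite -[fun z => _]/(L \o f); apply: smooth_on_comp_lin => //.
exact: matrix_normedtype.coord_continuous.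
Qed.

Lemma smooth_on_sum E (F : normedModType R) n (A : set E) (f : 'I_n -> E -> F) :
  open A -> (forall i, smooth_on A (f i)) -> smooth_on A (\sum_i f i).
Proof.
move=> oA sf; elim/big_ind : _ => //; first exact: (@smooth_on_cst _ _ _ _ 0).
by move=> *; exact: smooth_onD.
Qed.

Lemma smooth_on_row E n (A : set E) (f : E -> 'rV[R]_n) :
  open A -> (forall j, smooth_on A (fun z => f z 0 j)) -> smooth_on A f.
Proof.
move=> oA sf; have -> : f = \sum_(j < n) (fun z => f z 0 j *: delta_mx 0 j).
  apply/funext => z; rewrite fct_sumE; apply/rowP => i.
  by rewrite {1}[f z]row_sum_delta.
by apply: smooth_on_sum => // j; exact: smooth_on_scale.
Qed.

Lemma smooth_onN E (A : set E) (f : E -> R) :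
  open A -> smooth_on A f -> smooth_on A (- f).
Proof.
move=> oA sf; have -> : - f = cst (-1) * f.
  by apply/funext => z; rewrite !fctE mulN1r.
by apply: smooth_onM => //; exact: smooth_on_cst.
Qed.

Lemma smooth_onB E (A : set E) (f g : E -> R) :
  open A -> smooth_on A f -> smooth_on A g -> smooth_on A (f - g).
Proof. by move=> oA sf sg; apply: smooth_onD => //; exact: smooth_onN. Qed.

Lemma smooth_onX E (A : set E) (f : E -> R) n :
  open A -> smooth_on A f -> smooth_on A (f ^+ n).
Proof.
move=> oA sf; elim: n => [|n IH]; first exact: (smooth_on_cst (1 : R) oA).
by rewrite exprS; exact: smooth_onM.
Qed.

Lemma smooth_on_id E (A : set E) : open A -> smooth_on A (fun x : E => x).
Proof. by move=> oA; apply: (@smooth_on_lin _ _ _ _ idfun) => // x; exact: cvg_id. Qed.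

Lemma row_of_seqE n (s : seq R) (j : 'I_n) : row_of_seq n s 0 j = s`_j.
Proof. by rewrite mxE. Qed.

Lemma is_derive_row_of_seq E n (f : E -> seq R) (df : seq R) x v :
  (forall j : 'I_n, is_derive x v (fun z => (f z)`_j) df`_j) ->
  is_derive x v (fun z => row_of_seq n (f z)) (row_of_seq n df).
Proof.
move=> H; apply: is_derive_rowP => j; rewrite row_of_seqE.
by under eq_fun do rewrite row_of_seqE; exact: H.
Qed.
End SmoothCoordinates.

(** * The second derivative of the normal forms *)

Section NormalFormKernels.
Context {R : realType}.

(** Coordinates with indices in [nat], the form in which [wedge] and the normal
    forms are written. *)
Definition co (i : nat) (z : 'rV[R]_4) : R := z 0 (inord i).

Global Instance is_derive_co i z v : is_derive z v (co i) (co i v).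
Proof. by apply: is_derive_coord; exact: is_derive_id. Qed.

Lemma smooth_on_co i : smooth_on setT (co i).
Proof. by apply: smooth_on_coord; [exact: openT | exact/smooth_on_id/openT]. Qed.

Lemma co_rowP (x y : 'rV[R]_4) :
  (forall i, (i < 4)%N -> co i x = co i y) -> x = y.
Proof. by move=> H; apply/rowP => j; rewrite -[j]inord_val; exact: H. Qed.

Lemma co_row (s : seq R) i : (i < 4)%N -> co i (row_of_seq 4 s) = s`_i.
Proof. by move=> i4; rewrite /co row_of_seqE inordK. Qed.

Lemma co0 i : co i 0 = 0. Proof. by rewrite /co mxE. Qed.

Lemma is_derive_row4 (f0 f1 f2 f3 : 'rV[R]_4 -> R) d0 d1 d2 d3 x v :
  is_derive x v f0 d0 -> is_derive x v f1 d1 -> is_derive x v f2 d2 -> is_derive x v f3 d3 ->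
  is_derive x v (fun z => row_of_seq 4 [:: f0 z; f1 z; f2 z; f3 z])
    (row_of_seq 4 [:: d0; d1; d2; d3]).
Proof. by move=> H0 H1 H2 H3; apply: is_derive_row_of_seq => -[[|[|[|[|]]]] ?]. Qed.

Lemma smooth_on_row4 (f0 f1 f2 f3 : 'rV[R]_4 -> R) :
  smooth_on setT f0 -> smooth_on setT f1 -> smooth_on setT f2 -> smooth_on setT f3 ->
  smooth_on setT (fun z => row_of_seq 4 [:: f0 z; f1 z; f2 z; f3 z]).
Proof.
move=> H0 H1 H2 H3; apply: smooth_on_row; first exact: openT.
by move=> -[[|[|[|[|]]]] i4] //; under eq_fun do rewrite row_of_seqE /=.
Qed.

Definition basis4 i : 'rV[R]_4 := delta_mx 0 (inord i).
Lemma co_basis4 i j : (i < 4)%N -> (j < 4)%N -> co i (basis4 j) = (i == j)%:R.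
Proof. by move=> i4 j4; rewrite /co mxE eqxx -val_eqE /= !inordK. Qed.

(** For a normal form with explicit derivative [l] along a kernel vector k. *)
Lemma second_kernel_derive (g l : 'rV[R]_4 -> 'rV[R]_4) k w dl :
  in_second_kernel g 0 w -> (forall z, is_derive z k g (l z)) -> l 0 = 0 ->
  is_derive (0 : 'rV[R]_4) w l dl -> exists xi, dl = 'D_xi g 0.
Proof.
move=> gw gk l0 [_ ldl].
have gkE : 'D_k g = l by apply/funext => z; have [_ ->] := gk z.
have gk0 : 'D_k g 0 = 0 by have [_ ->] := gk 0.
by have [xi] := gw k gk0; rewrite gkE ldl => ->; exists xi.
Qed.

Lemma normal_C22pE : @normal_C22p R = fun z => row_of_seq 4
  [:: co 0 z; co 1 z; (co 2 ^+ 2 + co 0 * co 3) z; (co 3 ^+ 2 + co 1 * co 2) z].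
Proof. by []. Qed.

Lemma is_derive_normal_C22p z v : is_derive z v normal_C22p (row_of_seq 4
  [:: co 0 v; co 1 v;
      2 * co 2 z * co 2 v + co 0 z * co 3 v + co 3 z * co 0 v;
      2 * co 3 z * co 3 v + co 1 z * co 2 v + co 2 z * co 1 v]).
Proof.
rewrite normal_C22pE.
have H2 := is_deriveD (is_deriveX 2 (is_derive_co 2 z v))
  (is_deriveM (is_derive_co 0 z v) (is_derive_co 3 z v)).
have H3 := is_deriveD (is_deriveX 2 (is_derive_co 3 z v))
  (is_deriveM (is_derive_co 1 z v) (is_derive_co 2 z v)).
have H := is_derive_row4 (is_derive_co 0 z v) (is_derive_co 1 z v) H2 H3.
by apply: (is_derive_eq H); rewrite /GRing.scale /= !expr1 !addrA.
Qed.

Lemma smooth_normal_C22p p : smooth_at (@normal_C22p R) p.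
Proof.
exists setT; split => //; first exact: openT.
have o : open [set: 'rV[R]_4] := openT; have s := smooth_on_co.
by rewrite normal_C22pE; apply: smooth_on_row4 => //; apply: smooth_onD => //;
  (try apply: smooth_onM) => //; apply: smooth_onX.
Qed.

(** The derivatives along the kernel directions x and y are (2x, u2) and
    (u1, 2y) in the cokernel, and their coefficients are the four coordinates. *)
Lemma second_kernel_normal_C22p w : in_second_kernel (@normal_C22p R) 0 w -> w = 0.
Proof.
move=> gw.
pose l2 (z : 'rV[R]_4) := row_of_seq 4 [:: cst 0 z; cst 0 z; (2 *: co 2) z; co 1 z].
pose l3 (z : 'rV[R]_4) := row_of_seq 4 [:: cst 0 z; cst 0 z; co 0 z; (2 *: co 3) z].
have D2 z : is_derive z (basis4 2) (@normal_C22p R) (l2 z).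
  apply: (is_derive_eq (is_derive_normal_C22p z (basis4 2))).
  by rewrite !co_basis4 // !mulr0 !mulr1 !addr0 ?add0r.
have D3 z : is_derive z (basis4 3) (@normal_C22p R) (l3 z).
  apply: (is_derive_eq (is_derive_normal_C22p z (basis4 3))).
  by rewrite !co_basis4 // !mulr0 !mulr1 !addr0 ?add0r.
have l20 : l2 0 = 0.
  by apply: co_rowP => -[|[|[|[|]]]] // _; rewrite co_row //= ?fctE ?co0 // scaler0.
have l30 : l3 0 = 0.
  by apply: co_rowP => -[|[|[|[|]]]] // _; rewrite co_row //= ?fctE ?co0 // scaler0.
have [xi E2] := second_kernel_derive gw D2 l20
  (is_derive_row4 (is_derive_cst 0 0 w) (is_derive_cst 0 0 w)
    (is_deriveZ 2 (is_derive_co 2 0 w)) (is_derive_co 1 0 w)).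
have [xi' E3] := second_kernel_derive gw D3 l30
  (is_derive_row4 (is_derive_cst 0 0 w) (is_derive_cst 0 0 w)
    (is_derive_co 0 0 w) (is_deriveZ 2 (is_derive_co 3 0 w))).
have D0 v : 'D_v (@normal_C22p R) 0 = row_of_seq 4 [:: co 0 v; co 1 v; 0; 0].
  by have [_ ->] := is_derive_normal_C22p 0 v; rewrite !co0 !mulr0 !mul0r !addr0.
move: E2 E3; rewrite !D0 => E2 E3.
have /eqP := congr1 (co 2) E2; have /eqP := congr1 (co 3) E2.
have /eqP := congr1 (co 2) E3; have /eqP := congr1 (co 3) E3.
rewrite !co_row //= !scaler_eq0 !pnatr_eq0 /= => /eqP w3 /eqP w0 /eqP w1 /eqP w2.
by apply: co_rowP => -[|[|[|[|]]]] // _; rewrite co0.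
Qed.

Lemma normal_C22mE : @normal_C22m R = fun z => row_of_seq 4
  [:: co 0 z; co 1 z; (co 2 ^+ 2 - co 3 ^+ 2) z;
     (co 2 * co 3 + co 0 * co 2 + co 1 * co 3) z].
Proof. by []. Qed.

Lemma is_derive_normal_C22m z v : is_derive z v normal_C22m (row_of_seq 4
  [:: co 0 v; co 1 v;
      2 * co 2 z * co 2 v - 2 * co 3 z * co 3 v;
      co 2 z * co 3 v + co 3 z * co 2 v + (co 0 z * co 2 v + co 2 z * co 0 v)
       + (co 1 z * co 3 v + co 3 z * co 1 v)]).
Proof.
rewrite normal_C22mE.
have H2 := is_deriveB (is_deriveX 2 (is_derive_co 2 z v)) (is_deriveX 2 (is_derive_co 3 z v)).
have H3 := is_deriveD (is_deriveD (is_deriveM (is_derive_co 2 z v) (is_derive_co 3 z v))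
  (is_deriveM (is_derive_co 0 z v) (is_derive_co 2 z v)))
  (is_deriveM (is_derive_co 1 z v) (is_derive_co 3 z v)).
have H := is_derive_row4 (is_derive_co 0 z v) (is_derive_co 1 z v) H2 H3.
by apply: (is_derive_eq H); rewrite /GRing.scale /= !expr1.
Qed.

Lemma smooth_normal_C22m p : smooth_at (@normal_C22m R) p.
Proof.
exists setT; split => //; first exact: openT.
have o : open [set: 'rV[R]_4] := openT; have s := smooth_on_co.
rewrite normal_C22mE; apply: smooth_on_row4 => //.
  by apply: smooth_onB => //; apply: smooth_onX.
by apply: smooth_onD => //; [apply: smooth_onD => //|]; apply: smooth_onM.
Qed.

(** The derivatives along the kernel directions x and y are (2x, y + u1) and
    (-2y, x + u2) in the cokernel, four independent linear forms. *)
Lemma second_kernel_normal_C22m w : in_second_kernel (@normal_C22m R) 0 w -> w = 0.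
Proof.
move=> gw.
pose l2 (z : 'rV[R]_4) := row_of_seq 4 [:: cst 0 z; cst 0 z; (2 *: co 2) z; (co 3 + co 0) z].
pose l3 (z : 'rV[R]_4) := row_of_seq 4 [:: cst 0 z; cst 0 z; ((-2) *: co 3) z; (co 2 + co 1) z].
have D2 z : is_derive z (basis4 2) (@normal_C22m R) (l2 z).
  apply: (is_derive_eq (is_derive_normal_C22m z (basis4 2))).
  by rewrite !co_basis4 // !mulr0 !mulr1 ?subr0 !addr0 ?add0r.
have D3 z : is_derive z (basis4 3) (@normal_C22m R) (l3 z).
  apply: (is_derive_eq (is_derive_normal_C22m z (basis4 3))).
  by rewrite !co_basis4 // !mulr0 !mulr1 !addr0 ?add0r -mulNr.
have l20 : l2 0 = 0.
  by apply: co_rowP => -[|[|[|[|]]]] // _; rewrite co_row //= ?fctE ?co0 ?scaler0 ?addr0.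
have l30 : l3 0 = 0.
  by apply: co_rowP => -[|[|[|[|]]]] // _; rewrite co_row //= ?fctE ?co0 ?scaler0 ?addr0.
have [xi E2] := second_kernel_derive gw D2 l20
  (is_derive_row4 (is_derive_cst 0 0 w) (is_derive_cst 0 0 w)
    (is_deriveZ 2 (is_derive_co 2 0 w)) (is_deriveD (is_derive_co 3 0 w) (is_derive_co 0 0 w))).
have [xi' E3] := second_kernel_derive gw D3 l30
  (is_derive_row4 (is_derive_cst 0 0 w) (is_derive_cst 0 0 w)
    (is_deriveZ (-2) (is_derive_co 3 0 w)) (is_deriveD (is_derive_co 2 0 w) (is_derive_co 1 0 w))).
have D0 v : 'D_v (@normal_C22m R) 0 = row_of_seq 4 [:: co 0 v; co 1 v; 0; 0].
  by have [_ ->] := is_derive_normal_C22m 0 v; rewrite !co0 !mulr0 !mul0r ?subr0 !addr0.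
move: E2 E3; rewrite !D0 => E2 E3.
have := congr1 (co 3) E2; have /eqP := congr1 (co 2) E2.
have := congr1 (co 3) E3; have /eqP := congr1 (co 2) E3.
rewrite !co_row //= !scaler_eq0 ?oppr_eq0 !pnatr_eq0 /= => /eqP w3 + /eqP w2.
rewrite w3 w2 !add0r => w1 w0.
by apply: co_rowP => -[|[|[|[|]]]] // _; rewrite co0.
Qed.

(** The last component of the normal form A_k, for 1 <= k <= 4 (the default
    branch is k = 4). *)
Definition normal_A_last (k : nat) : 'rV[R]_4 -> R :=
  match k with
  | 1%N => co 3 ^+ 2
  | 2%N => co 3 ^+ 3 + co 0 * co 3
  | 3%N => co 3 ^+ 4 + co 0 * co 3 + co 1 * co 3 ^+ 2
  | _ => co 3 ^+ 5 + co 0 * co 3 + co 1 * co 3 ^+ 2 + co 2 * co 3 ^+ 3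
  end.

Lemma normal_AE k : (1 <= k <= 4)%N -> @normal_A R k = fun z => row_of_seq 4
  [:: co 0 z; co 1 z; co 2 z; normal_A_last k z].
Proof.
move: k => [|[|[|[|[|]]]]] // _; apply/funext => z; rewrite /normal_A /index_iota /= ?big_cons big_nil;
 by rewrite ?addr0 ?addrA.
Qed.

Definition normal_A_last_diff (k : nat) (v z : 'rV[R]_4) : R :=
  match k with
  | 1%N => 2 * co 3 z * co 3 v
  | 2%N => 3 * co 3 z ^+ 2 * co 3 v + (co 0 z * co 3 v + co 3 z * co 0 v)
  | 3%N => 4 * co 3 z ^+ 3 * co 3 v + (co 0 z * co 3 v + co 3 z * co 0 v)
     + (co 1 z * (2 * co 3 z * co 3 v) + co 3 z ^+ 2 * co 1 v)
  | _ => 5 * co 3 z ^+ 4 * co 3 v + (co 0 z * co 3 v + co 3 z * co 0 v)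
     + (co 1 z * (2 * co 3 z * co 3 v) + co 3 z ^+ 2 * co 1 v)
     + (co 2 z * (3 * co 3 z ^+ 2 * co 3 v) + co 3 z ^+ 3 * co 2 v)
  end.

Lemma is_derive_normal_A_last k z v : is_derive z v (normal_A_last k) (normal_A_last_diff k v z).
Proof.
have H n := is_deriveX n (is_derive_co 3 z v).
have H0 := is_deriveM (is_derive_co 0 z v) (is_derive_co 3 z v).
have H1 := is_deriveM (is_derive_co 1 z v) (H 2%N).
have H2 := is_deriveM (is_derive_co 2 z v) (H 3%N).
case: k => [|[|[|[|k]]]].
- apply: (is_derive_eq (is_deriveD (is_deriveD (is_deriveD (H 5%N) H0) H1) H2)).
  by rewrite /GRing.scale /= !expr1.
- by apply: (is_derive_eq (H 2%N)); rewrite /GRing.scale /= !expr1.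
- by apply: (is_derive_eq (is_deriveD (H 3%N) H0)); rewrite /GRing.scale /=.
- apply: (is_derive_eq (is_deriveD (is_deriveD (H 4%N) H0) H1)).
  by rewrite /GRing.scale /= !expr1.
- apply: (is_derive_eq (is_deriveD (is_deriveD (is_deriveD (H 5%N) H0) H1) H2)).
  by rewrite /GRing.scale /= !expr1.
Qed.

Lemma smooth_normal_A k p : (1 <= k <= 4)%N -> smooth_at (@normal_A R k) p.
Proof.
move=> k14; rewrite normal_AE //; exists setT; split => //; first exact: openT.
have o : open [set: 'rV[R]_4] := openT; have s := smooth_on_co.
have sX n : smooth_on setT (co 3 ^+ n) by apply: smooth_onX.
have s0 : smooth_on setT (co 0 * co 3) by apply: smooth_onM.
have s1 : smooth_on setT (co 1 * co 3 ^+ 2) by apply: smooth_onM.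
have s2 : smooth_on setT (co 2 * co 3 ^+ 3) by apply: smooth_onM.
apply: smooth_on_row4 => //.
by move: k {k14} => [|[|[|[|k]]]] /=; try exact: sX;
  do ?[exact: sX | exact: s0 | exact: s1 | exact: s2 | apply: smooth_onD => //].
Qed.

(** The last component differentiated along the kernel direction y is 2y for
    k = 1 and u1 + O(2) for k > 1; in both cases its differential at 0 is not
    zero. *)
Lemma second_kernel_normal_A_proper k : (1 <= k <= 4)%N ->
  exists w, ~ in_second_kernel (@normal_A R k) 0 w.
Proof.
move=> k14.
pose l (z : 'rV[R]_4) := row_of_seq 4 [:: cst 0 z; cst 0 z; cst 0 z; normal_A_last_diff k (basis4 3) z].
have Dz v z : is_derive z v (@normal_A R k)
    (row_of_seq 4 [:: co 0 v; co 1 v; co 2 v; normal_A_last_diff k v z]).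
  rewrite normal_AE //.
  exact: (is_derive_row4 (is_derive_co 0 z v) (is_derive_co 1 z v) (is_derive_co 2 z v)
    (is_derive_normal_A_last k z v)).
have D3 z : is_derive z (basis4 3) (@normal_A R k) (l z).
  by apply: (is_derive_eq (Dz _ z)); rewrite /l !co_basis4.
have Ad0 v : normal_A_last_diff k v 0 = 0.
  by move: k {k14 l Dz D3} => [|[|[|[|k]]]] /=; rewrite !co0 ?expr0n /= ?mulr0 ?mul0r ?addr0.
have l0 : l 0 = 0.
  by apply: co_rowP => -[|[|[|[|]]]] // _; rewrite co_row //= ?Ad0 co0.
have [w [d [dl dn0]]] : exists w d,
    is_derive (0 : 'rV[R]_4) w (normal_A_last_diff k (basis4 3)) d /\ d != 0.
  have H3 w := is_derive_co 3 0 w.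
  have HX n w := is_deriveX n (H3 w).
  have H0 w := is_derive_co 0 0 w.
  have H1 w := is_deriveM (is_derive_co 1 0 w) (H3 w).
  have H2 w := is_deriveM (is_derive_co 2 0 w) (HX 2%N w).
  have Ac : normal_A_last_diff k (basis4 3) = match k with
     | 1%N => 2 *: co 3
     | 2%N => 3 *: (co 3 ^+ 2) + co 0
     | 3%N => 4 *: (co 3 ^+ 3) + co 0 + 2 *: (co 1 * co 3)
     | _ => 5 *: (co 3 ^+ 4) + co 0 + 2 *: (co 1 * co 3) + 3 *: (co 2 * co 3 ^+ 2)
     end.
    move: k {k14 l Dz D3 Ad0 l0} => [|[|[|[|k]]]]; apply/funext => z /=;
      rewrite !co_basis4 //= !fctE /GRing.scale /=; ring.
  rewrite Ac.
  move: k k14 {l Dz D3 Ad0 l0 Ac} => [|[|[|[|[|k]]]]] // _.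
  - exists (basis4 3), 2; split; last by rewrite pnatr_eq0.
    by apply: (is_derive_eq (is_deriveZ 2 (H3 _)));
      rewrite co_basis4 // /GRing.scale /= mulr1.
  - exists (basis4 0), 1; split; last by rewrite oner_eq0.
    apply: (is_derive_eq (is_deriveD (is_deriveZ 3 (HX 2%N _)) (H0 _))).
    rewrite /GRing.scale /= !co_basis4 //= !co0; ring.
  - exists (basis4 0), 1; split; last by rewrite oner_eq0.
    apply: (is_derive_eq (is_deriveD (is_deriveD
      (is_deriveZ 4 (HX 3%N _)) (H0 _)) (is_deriveZ 2 (H1 _)))).
    rewrite /GRing.scale /= !co_basis4 //= !co0; ring.
  - exists (basis4 0), 1; split; last by rewrite oner_eq0.
    apply: (is_derive_eq (is_deriveD (is_deriveD (is_deriveD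
      (is_deriveZ 5 (HX 4%N _)) (H0 _)) (is_deriveZ 2 (H1 _))) (is_deriveZ 3 (H2 _)))).
    rewrite /GRing.scale /= !co_basis4 //= !co0; ring.
exists w => gw.
have [xi] := second_kernel_derive gw D3 l0
  (is_derive_row4 (is_derive_cst 0 0 w) (is_derive_cst 0 0 w) (is_derive_cst 0 0 w) dl).
have [_ ->] := Dz xi 0; rewrite Ad0 => /(congr1 (co 3)).
by rewrite !co_row //= => /eqP; rewrite (negbTE dn0).
Qed.

End NormalFormKernels.

(** * Bivectors of R^4 *)

Section Bivectors.
Context {R : realType}.
Implicit Types (u v : 'rV[R]_4) (p q : 'rV[R]_6).

Definition bi (i : nat) (p : 'rV[R]_6) : R := p 0 (inord i).

Lemma bi_rowP p q : (forall i, (i < 6)%N -> bi i p = bi i q) -> p = q.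
Proof. by move=> H; apply/rowP => j; rewrite -[j]inord_val; exact: H. Qed.

Lemma bi_row (s : seq R) i : (i < 6)%N -> bi i (row_of_seq 6 s) = s`_i.
Proof. by move=> i6; rewrite /bi row_of_seqE inordK. Qed.

Lemma coD i u v : co i (u + v) = co i u + co i v. Proof. by rewrite /co mxE. Qed.
Lemma coZ i c u : co i (c *: u) = c * co i u. Proof. by rewrite /co mxE. Qed.
Lemma coN i u : co i (- u) = - co i u. Proof. by rewrite /co mxE. Qed.
Lemma biD i p q : bi i (p + q) = bi i p + bi i q. Proof. by rewrite /bi mxE. Qed.
Lemma biZ i c p : bi i (c *: p) = c * bi i p. Proof. by rewrite /bi mxE. Qed.
Lemma biN i p : bi i (- p) = - bi i p. Proof. by rewrite /bi mxE. Qed.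
Lemma bi0 i : bi i 0 = 0. Proof. by rewrite /bi mxE. Qed.

Definition coE := (coD, coZ, coN, @co0 R).
Definition biE := (biD, biZ, biN, bi0).

Lemma wedgeE u v : wedge u v = row_of_seq 6
  [:: co 0 u * co 1 v - co 1 u * co 0 v; co 0 u * co 2 v - co 2 u * co 0 v;
      co 0 u * co 3 v - co 3 u * co 0 v; co 1 u * co 2 v - co 2 u * co 1 v;
      co 1 u * co 3 v - co 3 u * co 1 v; co 2 u * co 3 v - co 3 u * co 2 v].
Proof. by []. Qed.

Lemma wedge2E p q : wedge2 p q = bi 0 p * bi 5 q - bi 1 p * bi 4 q + bi 2 p * bi 3 q
  + bi 3 p * bi 2 q - bi 4 p * bi 1 q + bi 5 p * bi 0 q.
Proof. by []. Qed.

Ltac bivec := rewrite ?wedgeE; apply: bi_rowP => -[|[|[|[|[|[|]]]]]] // _;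
  rewrite ?biE ?bi_row //= ?biE ?coE; ring.

Lemma wedge_addl u u' v : wedge (u + u') v = wedge u v + wedge u' v. Proof. bivec. Qed.
Lemma wedge_addr u v v' : wedge u (v + v') = wedge u v + wedge u v'. Proof. bivec. Qed.
Lemma wedge_scalel c u v : wedge (c *: u) v = c *: wedge u v. Proof. bivec. Qed.
Lemma wedge_scaler c u v : wedge u (c *: v) = c *: wedge u v. Proof. bivec. Qed.
Lemma wedge_self u : wedge u u = 0. Proof. bivec. Qed.
Lemma wedgeC u v : wedge u v = - wedge v u. Proof. bivec. Qed.

Lemma wedge2_addl p p' q : wedge2 (p + p') q = wedge2 p q + wedge2 p' q.
Proof. rewrite !wedge2E !biE; ring. Qed.
Lemma wedge2_addr p q q' : wedge2 p (q + q') = wedge2 p q + wedge2 p q'.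
Proof. rewrite !wedge2E !biE; ring. Qed.
Lemma wedge2_scalel c p q : wedge2 (c *: p) q = c * wedge2 p q.
Proof. rewrite !wedge2E !biE; ring. Qed.
Lemma wedge2_scaler c p q : wedge2 p (c *: q) = c * wedge2 p q.
Proof. rewrite !wedge2E !biE; ring. Qed.
Lemma wedge2C p q : wedge2 p q = wedge2 q p.
Proof. rewrite !wedge2E; ring. Qed.

Ltac scal4 := rewrite !wedge2E !wedgeE !bi_row //= ?coE; ring.

Lemma wedge2_abac (a b c : 'rV[R]_4) : wedge2 (wedge a b) (wedge a c) = 0.
Proof. scal4. Qed.
Lemma wedge2_abbc (a b c : 'rV[R]_4) : wedge2 (wedge a b) (wedge b c) = 0.
Proof. scal4. Qed.
Lemma wedge2_abcb (a b c : 'rV[R]_4) : wedge2 (wedge a b) (wedge c b) = 0.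
Proof. scal4. Qed.
Lemma wedge2_abab (a b : 'rV[R]_4) : wedge2 (wedge a b) (wedge a b) = 0.
Proof. scal4. Qed.
Lemma wedge2_swap_ac (a b c d : 'rV[R]_4) :
  wedge2 (wedge a b) (wedge c d) = - wedge2 (wedge c b) (wedge a d).
Proof. scal4. Qed.

(** The determinant of four vectors, in the form in which [wedge2] produces it. *)
Definition vol (a b c d : 'rV[R]_4) : R := wedge2 (wedge a b) (wedge c d).

(** Cramer's rule.  It is an identity of polynomials, so it also detects linear
    dependence when the determinant vanishes. *)
Lemma vol_cramer e u v z x : vol e u v z *: x =
  vol x u v z *: e + vol e x v z *: u + vol e u x z *: v + vol e u v x *: z.
Proof.
apply: co_rowP => -[|[|[|[|]]]] // _; rewrite /vol ?coE !wedge2E !wedgeE !bi_row //=; ring.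
Qed.

(** Cramer's rule in the second exterior power: the coordinates of [x] in the
    basis of wedges of four vectors are its pairings with the complementary
    wedges. *)
Lemma bivector_cramer e u v z x : vol e u v z *: x =
  wedge2 x (wedge v z) *: wedge e u - wedge2 x (wedge u z) *: wedge e v
  + wedge2 x (wedge u v) *: wedge e z + wedge2 x (wedge e z) *: wedge u v
  - wedge2 x (wedge e v) *: wedge u z + wedge2 x (wedge e u) *: wedge v z.
Proof.
apply: bi_rowP => -[|[|[|[|[|[|]]]]]] // _; rewrite /vol !biE !wedge2E !wedgeE !bi_row //=; ring.
Qed.

Lemma bi_wedge_basis p :
  [/\ bi 0 p = wedge2 p (wedge (basis4 2) (basis4 3)),
      bi 1 p = - wedge2 p (wedge (basis4 1) (basis4 3)),
      bi 2 p = wedge2 p (wedge (basis4 1) (basis4 2)),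
      bi 3 p = wedge2 p (wedge (basis4 0) (basis4 3)) &
      bi 4 p = - wedge2 p (wedge (basis4 0) (basis4 2)) /\
      bi 5 p = wedge2 p (wedge (basis4 0) (basis4 1)) ].
Proof.
split; last split; rewrite !wedge2E !wedgeE !bi_row //= !co_basis4 //=; ring.
Qed.

Lemma wedge2_nondegenerate p : (forall u v, wedge2 p (wedge u v) = 0) -> p = 0.
Proof.
move=> H; have [p0 p1 p2 p3 [p4 p5]] := bi_wedge_basis p.
by apply: bi_rowP => -[|[|[|[|[|[|]]]]]] // _; rewrite bi0 ?p0 ?p1 ?p2 ?p3 ?p4 ?p5 H ?oppr0.
Qed.

Lemma wedge2_nondegenerate_neq p : p != 0 -> exists u v, wedge2 p (wedge u v) != 0.
Proof.
move=> p0; apply: contrapT => H; move/eqP: p0; apply.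
apply: wedge2_nondegenerate => u v; apply: contrapT => /eqP n0.
by apply: H; exists u, v.
Qed.

Lemma wedge_eq0 u v : wedge u v = 0 -> forall i, (i < 4)%N -> co i u *: v = co i v *: u.
Proof.
move=> H; have E i : (i < 6)%N -> bi i (wedge u v) = 0 by rewrite H bi0.
have S (i : nat) (i6 : (i < 6)%N) (x y : R) : bi i (wedge u v) = x - y -> x = y.
  by rewrite E // => /esym/eqP; rewrite subr_eq0 => /eqP.
have e0 : co 0 u * co 1 v = co 1 u * co 0 v by apply: (S 0%N isT); rewrite wedgeE bi_row.
have e1 : co 0 u * co 2 v = co 2 u * co 0 v by apply: (S 1%N isT); rewrite wedgeE bi_row.
have e2 : co 0 u * co 3 v = co 3 u * co 0 v by apply: (S 2%N isT); rewrite wedgeE bi_row.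
have e3 : co 1 u * co 2 v = co 2 u * co 1 v by apply: (S 3%N isT); rewrite wedgeE bi_row.
have e4 : co 1 u * co 3 v = co 3 u * co 1 v by apply: (S 4%N isT); rewrite wedgeE bi_row.
have e5 : co 2 u * co 3 v = co 3 u * co 2 v by apply: (S 5%N isT); rewrite wedgeE bi_row.
by move=> [|[|[|[|]]]] // _; apply: co_rowP => -[|[|[|[|]]]] // _; rewrite !coE [RHS]mulrC;
  rewrite ?e0 ?e1 ?e2 ?e3 ?e4 ?e5.
Qed.

(** Complete e, u to a basis y, z and expand v by Cramer's rule: the coefficients
    of y and z are volumes containing e, u and v. *)
Lemma span2_of_vol e u v : wedge e u != 0 -> (forall z, vol e u v z = 0) ->
  exists x y, v = x *: e + y *: u.
Proof.
move=> /wedge2_nondegenerate_neq[y [z yz]] H.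
have := vol_cramer e u y z v.
have -> : vol e u y v = 0.
  have -> : vol e u y v = - vol e u v y by rewrite /vol (wedgeC y) -scaleN1r wedge2_scaler mulN1r.
  by rewrite H oppr0.
rewrite H !scale0r !addr0 => E.
exists ((vol e u y z)^-1 * vol v u y z), ((vol e u y z)^-1 * vol e v y z).
by rewrite -!scalerA -scalerDr -E scalerA mulVf // scale1r.
Qed.

Lemma span3_of_vol e u v z x : vol e u v z != 0 -> vol e u v x = 0 ->
  exists r s t, x = r *: e + s *: u + t *: v.
Proof.
move=> D0 x0; have := vol_cramer e u v z x; rewrite x0 scale0r addr0 => E.
exists ((vol e u v z)^-1 * vol x u v z), ((vol e u v z)^-1 * vol e x v z),
  ((vol e u v z)^-1 * vol e u x z).
by rewrite -!scalerA -!scalerDr -E scalerA mulVf // scale1r.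
Qed.

(** The tangent space of the cone over Gr(2,4) at e /\ u.  In a basis starting
    with e and u, the pairing with e /\ u reads off the coefficient of the only
    basis wedge containing neither of them. *)
Lemma tangent_decomposition e u x : wedge e u != 0 -> wedge2 (wedge e u) x = 0 ->
  exists al be, x = wedge e al + wedge be u.
Proof.
move=> /wedge2_nondegenerate_neq[v [z D0]] px.
have := bivector_cramer e u v z x; rewrite (wedge2C x (wedge e u)) px scale0r addr0.
set c1 := wedge2 x _; set c2 := wedge2 x _; set c3 := wedge2 x _.
set c4 := wedge2 x _; set c5 := wedge2 x _.
move=> E; pose D := (vol e u v z)^-1.
exists (D *: (c1 *: u - c2 *: v + c3 *: z)), (D *: (- c4 *: v + c5 *: z)).
have -> : x = D *: (vol e u v z *: x) by rewrite scalerA mulVf // scale1r.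
rewrite E; bivec.
Qed.

Lemma plucker_decomposable p : wedge2 p p = 0 -> decomposable p.
Proof.
move=> pp.
have [->|p0] := eqVneq p 0; first by exists 0, 0; rewrite wedge_self.
(* The rows of the antisymmetric matrix of p; where the (i, j) entry does not
   vanish, rows i and j span the plane of p. *)
pose r0 := row_of_seq 4 [:: 0; bi 0 p; bi 1 p; bi 2 p].
pose r1 := row_of_seq 4 [:: - bi 0 p; 0; bi 3 p; bi 4 p].
pose r2 := row_of_seq 4 [:: - bi 1 p; - bi 3 p; 0; bi 5 p].
pose r3 := row_of_seq 4 [:: - bi 2 p; - bi 4 p; - bi 5 p; 0].
have P0 : bi 0 p * bi 5 p - bi 1 p * bi 4 p + bi 2 p * bi 3 p = 0.
  have : (1 + 1) * (bi 0 p * bi 5 p - bi 1 p * bi 4 p + bi 2 p * bi 3 p) = 0.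
    by rewrite -pp wedge2E; ring.
  by move/eqP; rewrite mulf_eq0 -mulr2n pnatr_eq0 /= => /eqP.
have main k (r s : 'rV[R]_4) (x : 'rV[R]_6) : bi k p != 0 ->
   wedge r s = bi k p *: p + (bi 0 p * bi 5 p - bi 1 p * bi 4 p + bi 2 p * bi 3 p) *: x ->
   decomposable p.
  move=> k0; rewrite P0 scale0r addr0 => E; exists ((bi k p)^-1 *: r), s.
  by rewrite wedge_scalel E scalerA mulVf // scale1r.
have : exists2 k, (k < 6)%N & bi k p != 0.
  apply: contrapT => H; move/eqP: p0; apply; apply: bi_rowP => i i6; rewrite bi0.
  by apply: contrapT => /eqP ni; apply: H; exists i.
have d i : (i < 6)%N -> forall j : nat, (j < 6)%N -> bi i (delta_mx 0 (inord j)) = (i == j)%:R.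
  by move=> i6 j j6; rewrite /bi mxE eqxx -val_eqE /= !inordK.
pose D (i : nat) : 'rV[R]_6 := delta_mx 0 (inord i).
have dD : forall i j, (i < 6)%N -> (j < 6)%N -> bi i (D j) = (i == j)%:R.
  by move=> i j i6 j6; exact: d.
move=> [[|[|[|[|[|[|]]]]]] // _ k0].
- by apply: (main _ r0 r1 (- D 5%N) k0); rewrite wedgeE; apply: bi_rowP;
    move=> [|[|[|[|[|[|]]]]]] // _;
    rewrite !biE dD // bi_row //= !co_row //=; ring.
- by apply: (main _ r0 r2 (D 4%N) k0); rewrite wedgeE; apply: bi_rowP;
    move=> [|[|[|[|[|[|]]]]]] // _;
    rewrite !biE dD // bi_row //= !co_row //=; ring.
- by apply: (main _ r0 r3 (- D 3%N) k0); rewrite wedgeE; apply: bi_rowP;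
    move=> [|[|[|[|[|[|]]]]]] // _;
    rewrite !biE dD // bi_row //= !co_row //=; ring.
- by apply: (main _ r1 r2 (- D 2%N) k0); rewrite wedgeE; apply: bi_rowP;
    move=> [|[|[|[|[|[|]]]]]] // _;
    rewrite !biE dD // bi_row //= !co_row //=; ring.
- by apply: (main _ r1 r3 (D 1%N) k0); rewrite wedgeE; apply: bi_rowP;
    move=> [|[|[|[|[|[|]]]]]] // _;
    rewrite !biE dD // bi_row //= !co_row //=; ring.
- by apply: (main _ r2 r3 (- D 0%N) k0); rewrite wedgeE; apply: bi_rowP;
    move=> [|[|[|[|[|[|]]]]]] // _;
    rewrite !biE dD // bi_row //= !co_row //=; ring.
Qed.
End Bivectors.

(** * Derivatives of wedge products *)

Section BilinearCalculus.
Context {R : realType}.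
Implicit Types E : normedModType R.

Lemma is_derive_wedge2 E (F G : E -> 'rV[R]_6) z v dF dG :
  is_derive z v F dF -> is_derive z v G dG ->
  is_derive z v (fun y => wedge2 (F y) (G y)) (wedge2 dF (G z) + wedge2 (F z) dG).
Proof.
move=> HF HG; have M i j := is_deriveM (is_derive_coord i HF) (is_derive_coord j HG).
pose M' i j := M (inord i) (inord j).
have H := is_deriveD (is_deriveB (is_deriveD (is_deriveD
  (is_deriveB (M' 0 5) (M' 1 4)) (M' 2 3)) (M' 3 2)) (M' 4 1)) (M' 5 0).
apply: (is_derive_eq H); rewrite /wedge2 /GRing.scale /=; ring.
Qed.

Lemma is_derive_wedge E (F G : E -> 'rV[R]_4) z v dF dG :
  is_derive z v F dF -> is_derive z v G dG ->
  is_derive z v (fun y => wedge (F y) (G y)) (wedge dF (G z) + wedge (F z) dG).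
Proof.
move=> HF HG; have M i j := is_deriveM (is_derive_coord i HF) (is_derive_coord j HG).
pose N i j := is_deriveB (M (inord i) (inord j)) (M (inord j) (inord i)).
apply: is_derive_rowP => -[[|[|[|[|[|[|]]]]]] j6] //; rewrite mxE !row_of_seqE /=;
  under eq_fun do rewrite row_of_seqE /=.
- apply: (is_derive_eq (N 0 1)); rewrite /GRing.scale /=; ring.
- apply: (is_derive_eq (N 0 2)); rewrite /GRing.scale /=; ring.
- apply: (is_derive_eq (N 0 3)); rewrite /GRing.scale /=; ring.
- apply: (is_derive_eq (N 1 2)); rewrite /GRing.scale /=; ring.
- apply: (is_derive_eq (N 1 3)); rewrite /GRing.scale /=; ring.
- apply: (is_derive_eq (N 2 3)); rewrite /GRing.scale /=; ring.
Qed.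

Lemma differentiable_wedge E (F G : E -> 'rV[R]_4) z :
  differentiable F z -> differentiable G z ->
  differentiable (fun y => wedge (F y) (G y)) z.
Proof.
move=> dF dG.
have N i j : differentiable (fun y => F y 0 (inord i) * G y 0 (inord j)
    - F y 0 (inord j) * G y 0 (inord i)) z.
  apply: (@differentiableB _ _ _ (fun y => F y 0 (inord i) * G y 0 (inord j))
    (fun y => F y 0 (inord j) * G y 0 (inord i)));
  exact: (@differentiableM _ _ (fun y => F y 0 _) (fun y => G y 0 _) _
    (differentiable_rowcoord _ dF) (differentiable_rowcoord _ dG)).
apply: differentiable_rowP => -[[|[|[|[|[|[|]]]]]] j6] //;
  by under eq_fun do rewrite row_of_seqE /=.
Qed.

Lemma smooth_on_wedge2 E (A : set E) (F G : E -> 'rV[R]_6) :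
  open A -> smooth_on A F -> smooth_on A G -> smooth_on A (fun y => wedge2 (F y) (G y)).
Proof.
move=> oA sF sG.
have M i j : smooth_on A ((fun y => F y 0 (inord i)) * (fun y => G y 0 (inord j))).
  by apply: smooth_onM => //; apply: smooth_on_coord.
exact: (smooth_onD oA (smooth_onB oA (smooth_onD oA (smooth_onD oA
  (smooth_onB oA (M 0 5) (M 1 4)) (M 2 3)) (M 3 2)) (M 4 1)) (M 5 0)).
Qed.

Lemma smooth_on_fst E1 E2 :
  smooth_on setT (@fst (NormedModule.sort E1) (NormedModule.sort E2)).
Proof.
apply: (@smooth_on_lin _ _ _ _ fst); first exact: openT.
by move=> x; exact: cvg_fst.
Qed.

Lemma smooth_on_snd E1 E2 :
  smooth_on setT (@snd (NormedModule.sort E1) (NormedModule.sort E2)).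
Proof.
apply: (@smooth_on_lin _ _ _ _ snd); first exact: openT.
by move=> x; exact: cvg_snd.
Qed.

Lemma differentiable_fst (E1 E2 : normedModType R) (z : E1 * E2) : differentiable fst z.
Proof. exact: (smooth_on_differentiable (@smooth_on_fst E1 E2)). Qed.

Lemma differentiable_snd (E1 E2 : normedModType R) (z : E1 * E2) : differentiable snd z.
Proof. exact: (smooth_on_differentiable (@smooth_on_snd E1 E2)). Qed.

Lemma is_derive_fst (E1 E2 : normedModType R) (z v : E1 * E2) : is_derive z v fst v.1.
Proof.
apply: is_derive_eq (is_derive_diff v (differentiable_fst z)) _.
by rewrite (@diff_lin _ _ _ fst)// => x; exact: cvg_fst.
Qed.

Lemma is_derive_snd (E1 E2 : normedModType R) (z v : E1 * E2) : is_derive z v snd v.2.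
Proof.
apply: is_derive_eq (is_derive_diff v (differentiable_snd z)) _.
by rewrite (@diff_lin _ _ _ snd)// => x; exact: cvg_snd.
Qed.
End BilinearCalculus.

(** * Affine charts of Gr(2,4) and of W *)

Section Charts.
Context {R : realType}.
Implicit Types (p q r x y : 'rV[R]_6) (k l : 'I_6).

Lemma pclass_refl p : pclass p p.
Proof. by exists 1; rewrite ?scale1r //= oner_neq0. Qed.

Lemma pclassZ c p : c != 0 -> pclass (c *: p) = pclass p.
Proof.
move=> c0; apply/seteqP; split => x [d /= d0 <-].
  by exists (d * c); rewrite /= ?mulf_neq0 // scalerA.
by exists (d / c); rewrite /= ?mulf_neq0 ?invr_neq0 // scalerA -mulrA mulVf // mulr1.
Qed.

Lemma eq_pclass p q : pclass p = pclass q -> exists2 c, c != 0 & p = c *: q.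
Proof. by move=> E; have := pclass_refl p; rewrite E => -[c c0 <-]; exists c. Qed.

Lemma chart_domE k p : chart_dom k (pclass p) <-> p 0 k != 0.
Proof.
split; last by move=> pk; exists p.
by move=> [q /= qk /esym/eq_pclass[c c0 ->]]; rewrite mxE mulf_neq0.
Qed.

Lemma chart_pclass k p : p 0 k != 0 -> chart k (pclass p) = (p 0 k)^-1 *: p.
Proof.
move=> pk; rewrite /chart; apply: xget_unique.
  split; first by exists (p 0 k)^-1; rewrite //= invr_neq0.
  by rewrite mxE mulVf.
move=> q [[c /= c0 <-]]; rewrite mxE => /(congr1 (fun t => t / p 0 k)).
by rewrite mulfK // mul1r => ->.
Qed.

Lemma decomposable_self p : decomposable p -> wedge2 p p = 0.
Proof. by move=> [u [v ->]]; exact: wedge2_abab. Qed.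

Lemma decomposableP p : decomposable p <-> wedge2 p p = 0.
Proof. by split; [exact: decomposable_self|exact: plucker_decomposable]. Qed.

Lemma decomposableZ c p : decomposable p -> decomposable (c *: p).
Proof. by move=> [u [v ->]]; exists (c *: u), v; rewrite wedge_scalel. Qed.

Lemma coord1_neq0 k p : p 0 k = 1 -> p != 0.
Proof.
by move=> pk; apply/eqP => p0; move: pk; rewrite p0 mxE => /esym/eqP; rewrite oner_eq0.
Qed.

Lemma in_chart_Gr24 k x : in_chart k Gr24 x -> x 0 k = 1 /\ wedge2 x x = 0.
Proof.
move=> [C [[p /= [p0 dp] <-] /chart_domE pk] <-].
rewrite chart_pclass // mxE mulVf //; split => //.
by apply/decomposableP/decomposableZ.
Qed.

Lemma in_chart2_Gr24 k l (z : 'rV[R]_6 * 'rV[R]_6) : in_chart2 k l (Gr24 `*` Gr24) z ->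
  [/\ z.1 0 k = 1, z.2 0 l = 1, wedge2 z.1 z.1 = 0 & wedge2 z.2 z.2 = 0].
Proof.
move=> [[C D] /= [[/= GC GD] [/= dC dD]] <-] /=.
have [? ?] : chart k C 0 k = 1 /\ wedge2 (chart k C) (chart k C) = 0.
  by apply: in_chart_Gr24; exists C.
have [? ?] : chart l D 0 l = 1 /\ wedge2 (chart l D) (chart l D) = 0.
  by apply: in_chart_Gr24; exists D.
by split.
Qed.

Lemma chart2_pclass k l p q : p 0 k = 1 -> q 0 l = 1 ->
  chart2_dom k l (pclass p, pclass q) /\ chart2 k l (pclass p, pclass q) = (p, q).
Proof.
move=> pk ql; split; first by split; apply/chart_domE; rewrite ?pk ?ql oner_eq0.
by rewrite /chart2 /= !chart_pclass ?pk ?ql ?oner_eq0 // invr1 !scale1r.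
Qed.

Lemma in_chart2_WP k l x y : in_chart2 k l W (x, y) <->
  [/\ x 0 k = 1, y 0 l = 1, wedge2 x x = 0, wedge2 y y = 0 & wedge2 x y = 0].
Proof.
split.
  move=> [_ [[p [q [[p0 dp] [q0 dq] -> pq]]] [/= /chart_domE pk /chart_domE ql]]].
  rewrite /chart2 /= !chart_pclass // => -[<- <-].
  rewrite !mxE !mulVf // !wedge2_scalel !wedge2_scaler pq !mulr0.
  by rewrite !decomposable_self // !mulr0; split.
move=> [xk yl xx yy xy]; have [dom ch] := chart2_pclass xk yl.
exists (pclass x, pclass y) => //; split => //.
exists x, y; split => //; split; try exact/decomposableP.
  exact: coord1_neq0 xk.
exact: coord1_neq0 yl.
Qed.
End Charts.

(** * Regular points of W *)

Section Wreg.
Context {R : realType}.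
Implicit Types (p q r x y : 'rV[R]_6) (k l : 'I_6).

(** In the chart (k, l), the ambient space is all of R^6 x R^6, so the two
    normalizations count among the equations: 2 + 2 + 1 of them. *)
Definition W_equations k l (z : 'rV[R]_6 * 'rV[R]_6) : 'rV[R]_5 := row_of_seq 5
  [:: z.1 0 k - 1; z.2 0 l - 1; wedge2 z.1 z.1; wedge2 z.2 z.2; wedge2 z.1 z.2].

Lemma smooth_W_equations k l : smooth_on setT (W_equations k l).
Proof.
have o : open [set: 'rV[R]_6 * 'rV[R]_6] := openT.
have s1 := @smooth_on_fst R 'rV[R]_6 'rV[R]_6; have s2 := @smooth_on_snd R 'rV[R]_6 'rV[R]_6.
have sB (f : 'rV[R]_6 * 'rV[R]_6 -> R) : smooth_on setT f -> smooth_on setT (fun z => f z - 1).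
  by move=> sf; exact: (smooth_onB o sf (smooth_on_cst (1 : R) o)).
apply: smooth_on_row => // -[[|[|[|[|[|]]]]] j5] //; under eq_fun do rewrite row_of_seqE /=.
- exact/sB/smooth_on_coord.
- exact/sB/smooth_on_coord.
- exact: smooth_on_wedge2.
- exact: smooth_on_wedge2.
- exact: smooth_on_wedge2.
Qed.

Lemma is_derive_W_equations k l z v : is_derive z v (W_equations k l) (row_of_seq 5
  [:: v.1 0 k; v.2 0 l; wedge2 v.1 z.1 + wedge2 z.1 v.1; wedge2 v.2 z.2 + wedge2 z.2 v.2;
      wedge2 v.1 z.2 + wedge2 z.1 v.2]).
Proof.
have d1 := is_derive_fst z v; have d2 := is_derive_snd z v.
have dB (f : 'rV[R]_6 * 'rV[R]_6 -> R) df :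
    is_derive z v f df -> is_derive z v (fun z => f z - 1) df.
  move=> sf; apply: (is_derive_eq (is_deriveB sf (is_derive_cst (1 : R) z v))).
  by rewrite subr0.
apply: is_derive_row_of_seq => -[[|[|[|[|[|]]]]] j5] //=.
- exact: dB (is_derive_coord k d1).
- exact: dB (is_derive_coord l d2).
- exact: is_derive_wedge2.
- exact: is_derive_wedge2.
- exact: is_derive_wedge2.
Qed.

(** Nondegeneracy of the pairing makes the equations independent as soon as
    [p] and [q] are not proportional; the bivector [r] orthogonal to [q] alone
    witnesses this. *)
Lemma W_reg_pair k l p q r : p 0 k = 1 -> q 0 l = 1 -> decomposable p -> decomposable q ->
  wedge2 p q = 0 -> wedge2 p r != 0 -> wedge2 q r = 0 -> W_reg (pclass p, pclass q).
Proof.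
move=> pk ql dp dq pq pr qr.
have p0 := coord1_neq0 pk; have q0 := coord1_neq0 ql.
split; first by exists p, q.
have [dom ch] := chart2_pclass pk ql.
exists k, l; split => //; rewrite ch.
exists (W_equations k l); split.
- by exists setT; split => //; [exact: openT | exact: smooth_W_equations].
- apply/seteqP; split => // t _.
  have pp := decomposable_self dp; have qq := decomposable_self dq.
  have [y1 [y2 sn0]] := wedge2_nondegenerate_neq q0.
  (* r and s are dual to p and q under the pairing. *)
  pose s := wedge y1 y2 - (wedge2 p (wedge y1 y2) / wedge2 p r) *: r.
  have ps : wedge2 p s = 0.
    by rewrite wedge2_addr -scaleNr wedge2_scaler mulNr mulfVK // subrr.
  have qs : wedge2 q s != 0 by rewrite wedge2_addr -scaleNr wedge2_scaler qr mulr0 addr0.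
  pose T (i : nat) : R := t 0 (inord i).
  pose x := (T 2%N / 2 / wedge2 p r) *: r + (T 4%N / wedge2 q s) *: s.
  pose y := (T 3%N / 2 / wedge2 q s) *: s.
  have px : wedge2 p x = T 2%N / 2.
    by rewrite wedge2_addr !wedge2_scaler ps mulr0 addr0 mulfVK.
  have qx : wedge2 q x = T 4%N.
    by rewrite wedge2_addr !wedge2_scaler qr mulr0 add0r mulfVK.
  have py : wedge2 p y = 0 by rewrite wedge2_scaler ps mulr0.
  have qy : wedge2 q y = T 3%N / 2 by rewrite wedge2_scaler mulfVK.
  (* p and q are orthogonal to themselves and to each other, so adding multiples
     of them adjusts the two normalizations alone. *)
  pose v := (x + (T 0%N - x 0 k) *: p, y + (T 1%N - y 0 l) *: q).
  exists v => //.
  have dW : differentiable (W_equations k l) (p, q).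
    exact: (smooth_on_differentiable (smooth_W_equations k l)).
  rewrite -deriveE //; have [_ ->] := is_derive_W_equations k l (p, q) v.
  have half (c : R) : c / 2 + c / 2 = c by rewrite -splitr.
  apply/rowP => -[j j5]; rewrite row_of_seqE /=.
  have -> : t 0 (Ordinal j5) = T j by rewrite /T; congr (t 0 _); apply/val_inj; rewrite /= inordK.
  move: j j5 => [|[|[|[|[|]]]]] // _ /=.
  + by rewrite !mxE pk mulr1 addrC subrK.
  + by rewrite !mxE ql mulr1 addrC subrK.
  + by rewrite (wedge2C _ p) wedge2_addr wedge2_scaler pp mulr0 addr0 px half.
  + by rewrite (wedge2C _ q) wedge2_addr wedge2_scaler qq mulr0 addr0 qy half.
  + rewrite (wedge2C _ q) (wedge2_addr q x) (wedge2_addr p y) (wedge2_scaler _ q p).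
    by rewrite (wedge2_scaler _ p q) (wedge2C q p) pq !mulr0 !addr0 qx py addr0.
- apply: filterE => -[x y]; rewrite in_chart2_WP; split.
    move=> [xk yl xx yy xy]; apply/rowP => -[j j5]; rewrite row_of_seqE mxE /=.
    by move: j j5 => [|[|[|[|[|]]]]] // _ /=; rewrite ?xk ?yl ?subrr.
  move=> H; have S (i : nat) (i5 : (i < 5)%N) :
      [:: x 0 k - 1; y 0 l - 1; wedge2 x x; wedge2 y y; wedge2 x y]`_i = 0.
    have := congr1 (fun M : 'rV[R]_5 => M 0 (Ordinal i5)) H.
    by rewrite row_of_seqE mxE.
  split; [|  | exact: (S 2%N isT) | exact: (S 3%N isT) | exact: (S 4%N isT)].
    by apply/eqP; rewrite -subr_eq0; apply/eqP; exact: (S 0%N isT).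
  by apply/eqP; rewrite -subr_eq0; apply/eqP; exact: (S 1%N isT).
Qed.

End Wreg.

(** * The diagonal of W *)

Section WSing.
Context {R : realType}.
Implicit Types (p q r x y : 'rV[R]_6) (k l : 'I_6).

(** Lines in X suffice to find kernel vectors of the differential of an
    equation of X. *)
Lemma diff_along_line (E F : normedModType R) (h : E -> F) (X : set E) (z v : E) :
  differentiable h z -> (\forall y \near z, X y <-> h y = 0) ->
  (forall t : R, X (t *: v + z)) -> 'd h z v = 0.
Proof.
move=> dh hX Xline; rewrite -deriveE //.
have hz : h z = 0.
  by apply/(nbhs_singleton hX); have := Xline 0; rewrite scale0r add0r.
apply: cvg_lim => //; apply: cvg_near_cst; apply: cvg_within.
have near_line : \forall t \near (0 : R), h (t *: v + z) = 0.
  have hX0 : \forall y \near (0 : E), X (y + z) -> h (y + z) = 0.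
    have : \forall y \near z, X y -> h y = 0 by apply: filterS hX => y [].
    by rewrite (near_shift 0 z) subr0.
  by apply: filterS (near0Z v hX0) => t; apply; exact: Xline.
by apply: filterS near_line => t /= ->; rewrite hz subrr scaler0.
Qed.

(** At a diagonal point of W every first order deformation of one plane alone is
    a sum of two lines contained in W: turn the plane p around e or around u.
    Hence the differential of an equation of W is determined by its values on
    complements of the two tangent spaces, which have dimension 2 each: one
    vector for the scaling of p, one for a bivector r not orthogonal to p. *)
Lemma wedge_diag_span k l p s r (h : 'rV[R]_6 * 'rV[R]_6 -> 'rV[R]_5) :
  p 0 k = 1 -> (s *: p) 0 l = 1 -> decomposable p -> wedge2 p r != 0 ->
  differentiable h (p, s *: p) ->
  (\forall z \near (p, s *: p), in_chart2 k l W z <-> h z = 0) ->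
  forall v, exists a b c d, 'd h (p, s *: p) v =
    a *: 'd h (p, s *: p) (p, 0) + b *: 'd h (p, s *: p) (r, 0)
    + c *: 'd h (p, s *: p) (0, s *: p) + d *: 'd h (p, s *: p) (0, r).
Proof.
move=> pk ql dp pr dh hW.
have pp := decomposable_self dp.
have s0 : s != 0.
  by apply/eqP => s0; move: ql; rewrite s0 scale0r mxE => /esym/eqP; rewrite oner_eq0.
set q := s *: p in ql dh hW *; set z := (p, q) in dh hW *.
have in1 x : x 0 k = 0 -> wedge2 x x = 0 -> wedge2 p x = 0 -> 'd h z (x, 0) = 0.
  move=> xk xx px; apply: (diff_along_line dh hW) => t.
  have -> : t *: (x, 0) + z = (t *: x + p, q) :> 'rV[R]_6 * 'rV[R]_6.
    by congr pair; rewrite /= scaler0 add0r.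
  have xp : wedge2 x p = 0 by rewrite wedge2C.
  apply/in_chart2_WP; split => //; first by rewrite !mxE xk mulr0 add0r.
  - by rewrite !(wedge2_addl, wedge2_addr, wedge2_scalel, wedge2_scaler) xx px xp pp !(mulr0, addr0).
  - by rewrite /q wedge2_scalel wedge2_scaler pp !mulr0.
  - by rewrite /q wedge2_scaler wedge2_addl wedge2_scalel xp pp mulr0 addr0 mulr0.
have in2 x : x 0 l = 0 -> wedge2 x x = 0 -> wedge2 p x = 0 -> 'd h z (0, x) = 0.
  move=> xk xx px; apply: (diff_along_line dh hW) => t.
  have -> : t *: (0, x) + z = (p, t *: x + q) :> 'rV[R]_6 * 'rV[R]_6.
    by congr pair; rewrite /= scaler0 add0r.
  have xp : wedge2 x p = 0 by rewrite wedge2C.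
  apply/in_chart2_WP; split => //; first by rewrite 2!mxE xk mulr0 add0r.
  - by rewrite /q !(wedge2_addl, wedge2_addr, wedge2_scalel, wedge2_scaler) xx px xp pp !(mulr0, addr0).
  - by rewrite /q wedge2_addr !wedge2_scaler px pp !mulr0 addr0.
have [e [u pE]] := dp.
have split_tangent m c x : c != 0 -> (c *: p) 0 m = 1 -> x 0 m = 0 -> wedge2 p x = 0 ->
    exists x1 x2, [/\ x = x1 + x2, (x1 0 m = 0 /\ wedge2 x1 x1 = 0 /\ wedge2 p x1 = 0)
      & (x2 0 m = 0 /\ wedge2 x2 x2 = 0 /\ wedge2 p x2 = 0)].
  move=> c0 cm xm px; have p0 : wedge e u != 0 by rewrite -pE; exact: coord1_neq0 pk.
  have [al [be xE]] : exists al be, x = wedge e al + wedge be u.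
    by apply: tangent_decomposition => //; rewrite -pE.
  have [f fE] : exists f, f = (wedge e al) 0 m * c by exists ((wedge e al) 0 m * c).
  have [g gE] : exists g, g = (wedge be u) 0 m * c by exists ((wedge be u) 0 m * c).
  have fg : f + g = 0 by rewrite fE gE -mulrDl; move: xm; rewrite xE mxE => ->; rewrite mul0r.
  have cm' : c * (wedge e u) 0 m = 1 by rewrite -pE -cm mxE.
  (* Corrections by multiples of e /\ u keep the m-th coordinate constant along
     each of the two lines; they cancel in the sum. *)
  exists (wedge e (al - f *: u)), (wedge (be - g *: e) u); split.
  - rewrite wedge_addr wedge_addl -!scaleNr wedge_scaler wedge_scalel xE.
    by rewrite addrACA -scalerDl -opprD fg oppr0 scale0r addr0.
  - split; last by rewrite pE !wedge2_abac.
    rewrite wedge_addr -scaleNr wedge_scaler mxE [(_ *: wedge e u) 0 m]mxE fE.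
    by rewrite mulNr -mulrA cm' mulr1 subrr.
  - split; last by rewrite pE !wedge2_abcb.
    rewrite wedge_addl -scaleNr wedge_scalel mxE [(_ *: wedge e u) 0 m]mxE gE.
    by rewrite mulNr -mulrA cm' mulr1 subrr.
have k1 x : x 0 k = 0 -> wedge2 p x = 0 -> 'd h z (x, 0) = 0.
  move=> xk px; have := split_tangent k 1 x (oner_neq0 _); rewrite scale1r => /(_ pk xk px).
  move=> [x1 [x2 [-> [a1 [b1 c1]] [a2 [b2 c2]]]]].
  have -> : (x1 + x2, 0) = (x1, 0) + (x2, 0) :> 'rV[R]_6 * 'rV[R]_6.
    by congr pair; rewrite /= addr0.
  by rewrite linearD !in1 // addr0.
have k2 x : x 0 l = 0 -> wedge2 p x = 0 -> 'd h z (0, x) = 0.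
  move=> xk px; have [x1 [x2 [-> [a1 [b1 c1]] [a2 [b2 c2]]]]] := split_tangent l s x s0 ql xk px.
  have -> : (0, x1 + x2) = (0, x1) + (0, x2) :> 'rV[R]_6 * 'rV[R]_6.
    by congr pair; rewrite /= addr0.
  by rewrite linearD !in2 // addr0.
move=> [v1 v2].
have [b bE] : exists b, wedge2 p v1 = b * wedge2 p r.
  by exists (wedge2 p v1 / wedge2 p r); rewrite mulfVK.
have [d dE] : exists d, wedge2 p v2 = d * wedge2 p r.
  by exists (wedge2 p v2 / wedge2 p r); rewrite mulfVK.
have [a aE] : exists a, a = (v1 - b *: r) 0 k by exists ((v1 - b *: r) 0 k).
have [c cE] : exists c, c = (v2 - d *: r) 0 l by exists ((v2 - d *: r) 0 l).
exists a, b, c, d.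
have -> : (v1, v2) = a *: (p, 0) + b *: (r, 0) + c *: (0, q) + d *: (0, r)
    + (v1 - b *: r - a *: p, 0) + (0, v2 - d *: r - c *: q) :> 'rV[R]_6 * 'rV[R]_6.
  congr pair; rewrite /= !scaler0 !addr0 ?add0r.
    by rewrite [RHS]addrC addrA !subrK.
  by rewrite [RHS]addrC addrA !subrK.
have z1 : 'd h z (v1 - b *: r - a *: p, 0) = 0.
  apply: k1; first by rewrite mxE [(- (a *: p)) 0 k]mxE [(a *: p) 0 k]mxE pk mulr1 aE addrN.
  by rewrite !wedge2_addr -!scaleNr !wedge2_scaler pp bE !(mulr0, oppr0, addr0) mulNr subrr.
have z2 : 'd h z (0, v2 - d *: r - c *: q) = 0.
  apply: k2; first by rewrite mxE [(- (c *: q)) 0 l]mxE [(c *: q) 0 l]mxE ql mulr1 cE addrN.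
  by rewrite !wedge2_addr -!scaleNr !wedge2_scaler pp dE !(mulr0, oppr0, addr0) mulNr subrr.
rewrite linearD z2 addr0 linearD z1 addr0.
by rewrite !linearD !linearZ.
Qed.

(** By [wedge_diag_span] a differential onto R^5 would have rank at most 4. *)
Lemma diagonal_not_W_reg p : p != 0 -> decomposable p -> ~ W_reg (pclass p, pclass p).
Proof.
move=> p0 dp [_ [k [l [[/= /chart_domE pk /chart_domE pl]]]]].
rewrite /chart2 /= !chart_pclass //.
set P := _ *: p; have -> : (p 0 l)^-1 *: p = (p 0 k / p 0 l) *: P.
  by rewrite /P scalerA mulrAC mulfV // mul1r.
move=> sub.
(* The codimension 12 - 7 of W_reg computes to 5. *)
have [h [sh rg hW]] : @submanifold_at R _ 5 (in_chart2 k l W) (P, (p 0 k / p 0 l) *: P) := sub.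
have dh : differentiable h (P, (p 0 k / p 0 l) *: P) := smooth_at_differentiable [::] sh.
have Pk : P 0 k = 1 by rewrite mxE mulVf.
have Ql : ((p 0 k / p 0 l) *: P) 0 l = 1.
  by rewrite /P scalerA mulrAC mulfV // mul1r mxE mulVf.
have dP : decomposable P := decomposableZ _ dp.
have [y1 [y2 Pr]] := wedge2_nondegenerate_neq (coord1_neq0 Pk).
have span := wedge_diag_span Pk Ql dP Pr dh hW.
set D := 'd h _ in span rg; set v1 := D _ in span; set v2 := D (wedge _ _, _) in span.
set v3 := D (0, _ *: _) in span; set v4 := D (0, wedge _ _) in span.
pose S := \matrix_(i < 4) nth 0 [:: v1; v2; v3; v4] i : 'M[R]_(4, 5).
have rS (i : nat) (i4 : (i < 4)%N) : (nth 0 [:: v1; v2; v3; v4] i <= S)%MS.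
  have -> : nth 0 [:: v1; v2; v3; v4] i = row (Ordinal i4) S by rewrite rowK.
  exact: row_sub.
have : row_full S.
  rewrite -sub1mx; apply/row_subP => i.
  have [v _ <-] : range D (row i 1%:M) by rewrite rg.
  have [a [b [c [d ->]]]] := span v.
  have [[[r1 r2] r3] r4] := (rS 0%N isT, rS 1%N isT, rS 2%N isT, rS 3%N isT).
  exact: (addmx_sub (addmx_sub (addmx_sub (scalemx_sub a r1) (scalemx_sub b r2))
    (scalemx_sub c r3)) (scalemx_sub d r4)).
by rewrite /row_full => /eqP rk; have := rank_leq_row S; rewrite rk.
Qed.
End WSing.

(** * Transversality to W *)

Section Transversality.
Context {R : realType}.
Implicit Types (p q r x y : 'rV[R]_6) (k l : 'I_6).

Lemma near_eq_cst_derive (E F : normedModType R) (f : E -> F) (c : F) z v df :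
  is_derive z v f df -> (\forall y \near z, f y = c) -> df = 0.
Proof. by move=> [_ <-] H; rewrite (near_eq_derive (g := cst c)) ?derive_cst. Qed.

(** First order form of the normalization and of the Plucker relation. *)
Lemma Gr24_tangent (E : normedModType R) (F : E -> 'rV[R]_6) k z v dF :
  is_derive z v F dF -> (\forall y \near z, F y 0 k = 1 /\ wedge2 (F y) (F y) = 0) ->
  dF 0 k = 0 /\ wedge2 (F z) dF = 0.
Proof.
move=> HF nF; split.
  have := near_eq_cst_derive (is_derive_coord k HF) (c := (1 : R)).
  by apply; apply: filterS nF => y [].
have := near_eq_cst_derive (is_derive_wedge2 HF HF) (c := (0 : R)).
rewrite wedge2C -mulr2n => H.
have /eqP : wedge2 (F z) dF *+ 2 = 0 by apply: H; apply: filterS nF => y [].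
by rewrite mulrn_eq0 => /eqP.
Qed.

Lemma near_neq0 (E : normedModType R) (f : E -> R) z :
  differentiable f z -> f z != 0 -> \forall y \near z, f y != 0.
Proof. by move=> df fz; apply: cvgr_neq0 fz; exact: differentiable_continuous. Qed.

Lemma is_derive_pair (E F G : normedModType R) (f : E -> F) (g : E -> G) z v df dg :
  differentiable f z -> differentiable g z ->
  is_derive z v f df -> is_derive z v g dg -> is_derive z v (fun a => (f a, g a)) (df, dg).
Proof.
move=> Df Dg [_ <-] [_ <-].
apply: is_derive_eq (is_derive_diff v (differentiable_pair Df Dg)) _.
by rewrite (diff_pair Df Dg) !deriveE.
Qed.

Lemma smooth_on_pair (E F G : normedModType R) (A : set E) (f : E -> F) (g : E -> G) :
  open A -> smooth_on A f -> smooth_on A g -> smooth_on A (fun a => (f a, g a)).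
Proof.
move=> oA sf sg.
apply: (smooth_on_coinduction (C := fun h : E -> F * G => exists f0 g0,
  [/\ smooth_on A f0, smooth_on A g0 & h = fun a => (f0 a, g0 a)]) oA).
- move=> h [f0 [g0 [sf0 sg0 ->]]] a Aa; apply: differentiable_pair.
    exact: smooth_on_differentiable sf0 Aa.
  exact: smooth_on_differentiable sg0 Aa.
- move=> h v [f0 [g0 [sf0 sg0 ->]]]; exists (fun a => ('D_v f0 a, 'D_v g0 a)).
    by exists ('D_v f0), ('D_v g0); split => //; exact: smooth_on_derive.
  move=> a /set_mem Aa.
  have df := smooth_on_differentiable sf0 Aa; have dg := smooth_on_differentiable sg0 Aa.
  by have [_ ->] := is_derive_pair df dg (is_derive_diff v df) (is_derive_diff v dg);
    rewrite !deriveE.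
- by exists f, g.
Qed.

(** The chart sends a quadratic curve of bivectors with velocity v to its
    quotient by the k-th coordinate; this coordinate has no linear term when v is
    tangent to the chart, hence the shape of the denominator. *)
Definition quadratic_curve (x v m : 'rV[R]_6) (c t : R) : 'rV[R]_6 :=
  (1 + t ^+ 2 * c)^-1 *: (x + t *: v + t ^+ 2 *: m).

Lemma quadratic_curve_coord x v m c t k : quadratic_curve x v m c t 0 k =
  (1 + t ^+ 2 * c)^-1 * (x 0 k + t * v 0 k + t ^+ 2 * m 0 k).
Proof. by rewrite !mxE. Qed.

Lemma smooth_quadratic (c : R) : smooth_on setT (fun t : R => 1 + t ^+ 2 * c).
Proof.
have o : open [set: R] := openT.
apply: (smooth_onD o (smooth_on_cst (1 : R) o)).
apply: (smooth_onM o _ (smooth_on_cst c o)).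
exact: (smooth_onX 2 o (smooth_on_id o)).
Qed.

Lemma open_quadratic (c : R) : open [set t : R | 1 + t ^+ 2 * c != 0].
Proof.
rewrite openE => t /= t0.
apply: (@near_neq0 _ (fun t : R => 1 + t ^+ 2 * c)) t0.
exact: (smooth_on_differentiable (smooth_quadratic c)).
Qed.

Lemma smooth_on_sub (E F : normedModType R) (A B : set E) (f : E -> F) :
  A `<=` B -> smooth_on B f -> smooth_on A f.
Proof. by move=> AB sf vs t At; exact: sf (AB _ At). Qed.

Lemma smooth_on_quadratic_curve (A : set R) x v m c :
  open A -> A `<=` [set t : R | 1 + t ^+ 2 * c != 0] ->
  smooth_on A (quadratic_curve x v m c).
Proof.
move=> oA Ac.
pose r (t : R) := (1 + t ^+ 2 * c)^-1.
have sr : smooth_on A r.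
  apply: smooth_onV => //.
  exact: smooth_on_sub (smooth_quadratic c).
have sid : smooth_on A (@id R) by exact: smooth_on_id.
have srt := smooth_onM oA sr sid; have srtt := smooth_onM oA srt sid.
have -> : quadratic_curve x v m c =
   (fun t => r t *: x) + (fun t => (r * id) t *: v) + (fun t => (r * id * id) t *: m).
  apply/funext => t; rewrite !fctE /r /quadratic_curve !scalerDr !scalerA.
  by rewrite expr2 mulrA.
by apply: smooth_onD => //; [apply: smooth_onD => //|]; exact: smooth_on_scale.
Qed.

Lemma is_derive_quadratic_curve x v m c :
  is_derive (0 : R) 1 (quadratic_curve x v m c) v.
Proof.
pose g (t : R) := 1 + t ^+ 2 * c.
have g0 : g 0 = 1 by rewrite /g expr0n mul0r addr0.
have Di := is_derive_id (0 : R) 1.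
have D2 := is_deriveX 2 Di.
have Dg : is_derive (0 : R) 1 g 0.
  have gE : g = cst 1 + id ^+ 2 * cst c by apply/funext => t; rewrite /g !fctE.
  rewrite gE.
  have H := is_deriveD (is_derive_cst (1 : R) (0 : R) 1) (is_deriveM D2 (is_derive_cst c (0 : R) 1)).
  refine (is_derive_eq H _).
  by rewrite /GRing.scale /= expr1 !(mulr0, mul0r, addr0).
have Dr : is_derive (0 : R) 1 (fun t => (g t)^-1) 0.
  have [dg gE] := Dg; apply: DeriveDef; first by apply: derivableV; rewrite ?g0 ?oner_neq0.
  by rewrite deriveV ?g0 ?oner_neq0 // gE scaler0.
have Dv := is_derive_scale Di (is_derive_cst v (0 : R) 1).
have Dm := is_derive_scale D2 (is_derive_cst m (0 : R) 1).
have H := is_derive_scale Dr (is_deriveD (is_deriveD (is_derive_cst x (0 : R) 1) Dv) Dm).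
apply: (is_derive_eq H).
by rewrite /= expr1 g0 invr1 mulr0 !(scale1r, scale0r, scaler0, addr0, add0r).
Qed.

Lemma is_derive_comp_fst (E F G : normedModType R) (f : E -> F * G) z w :
  differentiable f z -> is_derive z w (fun a => (f a).1) ('d f z w).1.
Proof.
move=> df.
apply: (is_derive_eq
  (is_derive_comp_diff df (is_derive_diff w df) (differentiable_fst _))).
by have [_ <-] := is_derive_fst (f z) ('d f z w); rewrite deriveE //; exact: differentiable_fst.
Qed.

Lemma is_derive_comp_snd (E F G : normedModType R) (f : E -> F * G) z w :
  differentiable f z -> is_derive z w (fun a => (f a).2) ('d f z w).2.
Proof.
move=> df.
apply: (is_derive_eq
  (is_derive_comp_diff df (is_derive_diff w df) (differentiable_snd _))).
by have [_ <-] := is_derive_snd (f z) ('d f z w); rewrite deriveE //; exact: differentiable_snd.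
Qed.

Lemma Gr24_square_tangent (E : normedModType R) (G : E -> 'rV[R]_6 * 'rV[R]_6) k l z w :
  differentiable G z -> (\forall a \near z, in_chart2 k l (Gr24 `*` Gr24) (G a)) ->
  [/\ ('d G z w).1 0 k = 0, wedge2 (G z).1 ('d G z w).1 = 0,
      ('d G z w).2 0 l = 0 & wedge2 (G z).2 ('d G z w).2 = 0].
Proof.
move=> dG nG.
have [] := Gr24_tangent (k := k) (is_derive_comp_fst w dG).
  by apply: filterS nG => a /in_chart2_Gr24[].
have [] := Gr24_tangent (k := l) (is_derive_comp_snd w dG).
  by apply: filterS nG => a /in_chart2_Gr24[].
by [].
Qed.

(** The curve ((e + t be) /\ (u + t al), (e + t be) /\ (v + t al')), normalized
    in the chart, consists of pairs of planes that meet along e + t be, and the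
    two planes of a pair remain distinct for small t. *)
Lemma W_reg_curve k l (e u v y al al' be : 'rV[R]_4) :
  wedge e u 0 k = 1 -> wedge e v 0 l = 1 -> vol e u v y != 0 ->
  (wedge e al + wedge be u) 0 k = 0 -> (wedge e al' + wedge be v) 0 l = 0 ->
  tangent_vector (in_chart2 k l W_reg) (wedge e u, wedge e v)
    (wedge e al + wedge be u, wedge e al' + wedge be v).
Proof.
move=> pk ql evol xk yl.
set x := wedge e al + wedge be u in xk *; set x' := wedge e al' + wedge be v in yl *.
have expand (b a : 'rV[R]_4) (t : R) : wedge (e + t *: be) (b + t *: a) =
    wedge e b + t *: (wedge e a + wedge be b) + t ^+ 2 *: wedge be a.
  rewrite !wedge_addl !wedge_addr !wedge_scalel !wedge_scaler scalerDr scalerA expr2.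
  by rewrite !addrA; congr (_ + _); rewrite -!addrA; congr (_ + _); rewrite addrC.
pose c1 := wedge be al 0 k; pose c2 := wedge be al' 0 l.
pose p t := quadratic_curve (wedge e u) x (wedge be al) c1 t.
pose q t := quadratic_curve (wedge e v) x' (wedge be al') c2 t.
have pE t : p t = (1 + t ^+ 2 * c1)^-1 *: wedge (e + t *: be) (u + t *: al) by rewrite expand.
have qE t : q t = (1 + t ^+ 2 * c2)^-1 *: wedge (e + t *: be) (v + t *: al') by rewrite expand.
have p0 : p 0 = wedge e u by rewrite pE expr0n mul0r !scale0r !addr0 invr1 scale1r.
have q0 : q 0 = wedge e v by rewrite qE expr0n mul0r !scale0r !addr0 invr1 scale1r.
have o1 := @open_quadratic c1; have o2 := @open_quadratic c2.
have oA := openI o1 o2; set A := _ `&` _ in oA.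
have A0 : A 0 by split; rewrite /= expr0n mul0r addr0 oner_neq0.
have sc : smooth_on A (fun t => (p t, q t)).
  by apply: smooth_on_pair => //; apply: smooth_on_quadratic_curve => // t [].
exists (fun t => (p t, q t)); split.
- by exists A.
- by rewrite p0 q0.
- have near_vol : \forall t \near (0 : R), vol (e + t *: be) (u + t *: al) (v + t *: al') y != 0.
    have D b a : differentiable (fun t : R => b + t *: a : 'rV[R]_4) 0.
      apply: (@differentiableD _ _ _ (cst b) (fun t : R => t *: a)); first exact: differentiable_cst.
      exact: (@differentiableZl _ _ _ (fun t : R => t) a).
    apply: near_neq0; last by rewrite !scale0r !addr0.
    have D' b a := is_derive_diff (1 : R) (D b a).
    apply/derivable1_diffP.
    by have [] := is_derive_wedge2 (is_derive_wedge (D' e be) (D' u al))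
      (is_derive_wedge (D' v al') (is_derive_cst y (0 : R) 1)).
  near=> t.
  have At : A t by near: t; exact: open_nbhs_nbhs.
  have vt : vol (e + t *: be) (u + t *: al) (v + t *: al') y != 0 by near: t.
  have [A1 A2] := At.
  have ptk : p t 0 k = 1.
    by rewrite quadratic_curve_coord pk xk mulr0 addr0 mulVf.
  have qtl : q t 0 l = 1.
    by rewrite quadratic_curve_coord ql yl mulr0 addr0 mulVf.
  have [dom ch] := chart2_pclass ptk qtl.
  exists (pclass (p t), pclass (q t)) => //; split => //.
  apply: (@W_reg_pair _ k l _ _ (wedge (v + t *: al') y)) => //.
  + by rewrite pE; apply: decomposableZ; exists (e + t *: be), (u + t *: al).
  + by rewrite qE; apply: decomposableZ; exists (e + t *: be), (v + t *: al').
  + by rewrite pE qE wedge2_scalel wedge2_scaler wedge2_abac !mulr0.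
  + by rewrite pE wedge2_scalel mulf_neq0 // invr_neq0.
  + by rewrite qE wedge2_scalel wedge2_abbc mulr0.
- rewrite derive1E; have Hp := is_derive_quadratic_curve (wedge e u) x (wedge be al) c1.
  have Hq := is_derive_quadratic_curve (wedge e v) x' (wedge be al') c2.
  have Dp : differentiable p 0 by apply/derivable1_diffP; case: Hp.
  have Dq : differentiable q 0 by apply/derivable1_diffP; case: Hq.
  by have [_ ->] := is_derive_pair Dp Dq Hp Hq.
Unshelve. all: by end_near. Qed.

(** The first order variation of the incidence of two planes sharing e depends
    only on the difference of the two variations of e. *)
Lemma wedge2_tangent_pair (e u v al al' be be' : 'rV[R]_4) :
  wedge2 (wedge e al + wedge be u) (wedge e v)
  + wedge2 (wedge e u) (wedge e al' + wedge be' v) = vol e u v (be - be').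
Proof.
rewrite wedge2_addl wedge2_addr !wedge2_abac !add0r.
rewrite /vol !wedge2E !wedgeE !bi_row //= !coE; ring.
Qed.

(** The incidence form has W as its zero set in Gr x Gr and its differential is
    onto R, so one direction w in which the map leaves W is enough: subtracting a
    multiple of w from a tangent vector of Gr x Gr makes it incident, and then
    [W_reg_curve] applies after the variations of e have been made equal. *)
Lemma transverse_to_W_reg (E : normedModType R) (G : E -> 'rV[R]_6 * 'rV[R]_6)
    z k l (e u v y : 'rV[R]_4) w :
  differentiable G z -> G z = (wedge e u, wedge e v) ->
  wedge e u 0 k = 1 -> wedge e v 0 l = 1 -> vol e u v y != 0 ->
  (\forall a \near z, in_chart2 k l (Gr24 `*` Gr24) (G a)) ->
  wedge2 ('d G z w).1 (wedge e v) + wedge2 (wedge e u) ('d G z w).2 != 0 ->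
  transverse_in G z (in_chart2 k l W_reg) (in_chart2 k l (Gr24 `*` Gr24)).
Proof.
move=> dG Gz pk ql evol nG; set om := _ + _ => om0 x [c [sc c0 nc <-]].
have dc : differentiable c 0 := smooth_at_differentiable [::] sc.
have [t1k pt1 t2l qt2] := Gr24_square_tangent (1 : R) dc nc.
have -> : c^`()%classic 0 = 'd c 0 1 by rewrite derive1E deriveE.
set t := 'd c 0 1 in t1k pt1 t2l qt2 *; rewrite c0 Gz /= in pt1 qt2.
have [g1k pg1 g2l qg2] := Gr24_square_tangent w dG nG.
rewrite Gz /= in pg1 qg2; rewrite Gz; rewrite /om in om0; set g := 'd G z w in g1k pg1 g2l qg2 om0.
have [s sE] : exists s, wedge2 t.1 (wedge e v) + wedge2 (wedge e u) t.2 =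
    s * (wedge2 g.1 (wedge e v) + wedge2 (wedge e u) g.2).
  by exists ((wedge2 t.1 (wedge e v) + wedge2 (wedge e u) t.2)
    / (wedge2 g.1 (wedge e v) + wedge2 (wedge e u) g.2)); rewrite mulfVK.
(* d is the part of t that preserves the incidence. *)
pose d := t - s *: g.
exists (s *: w), d; split; last by rewrite linearZ /= -/g addrC /d subrK.
have d1k : d.1 0 k = 0 by rewrite /d /= !mxE t1k g1k mulr0 subrr.
have d2l : d.2 0 l = 0 by rewrite /d /= !mxE t2l g2l mulr0 subrr.
have pd1 : wedge2 (wedge e u) d.1 = 0.
  by rewrite /d /= wedge2_addr -scaleNr wedge2_scaler pt1 pg1 mulr0 addr0.
have qd2 : wedge2 (wedge e v) d.2 = 0.
  by rewrite /d /= wedge2_addr -scaleNr wedge2_scaler qt2 qg2 mulr0 addr0.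
have omd : wedge2 d.1 (wedge e v) + wedge2 (wedge e u) d.2 = 0.
  rewrite /d /= wedge2_addr wedge2_addl -!scaleNr wedge2_scaler wedge2_scalel.
  by rewrite addrACA sE -mulrDr mulNr subrr.
have p0 := coord1_neq0 pk; have q0 := coord1_neq0 ql.
have [al [be d1E]] := tangent_decomposition p0 pd1.
have [al' [be' d2E]] := tangent_decomposition q0 qd2.
have vol0 : vol e u v (be - be') = 0.
  by rewrite -(wedge2_tangent_pair e u v al al') -d1E -d2E.
(* The components of be along u and of be' along v do not affect the bivectors
   they define, and the component along e moves to al'. *)
have [r [s1 [s2 bE]]] := span3_of_vol evol vol0.
have bE1 : be' = (be - s1 *: u) - r *: e - s2 *: v.
  have -> : be' = be - (be - be') by rewrite opprB addrC subrK.
  by rewrite bE !opprD !addrA; congr (_ - _); rewrite addrAC.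
have d1E' : d.1 = wedge e al + wedge (be - s1 *: u) u.
  by rewrite d1E wedge_addl -scaleNr wedge_scalel wedge_self scaler0 addr0.
have d2E' : d.2 = wedge e (al' - r *: v) + wedge (be - s1 *: u) v.
  rewrite d2E bE1 !wedge_addl wedge_addr -!scaleNr !wedge_scalel wedge_scaler wedge_self scaler0 addr0.
  by rewrite -!addrA; congr (_ + _); rewrite addrA addrC.
rewrite [d]surjective_pairing d1E' d2E'.
by apply: (W_reg_curve pk ql evol); rewrite -?d1E' -?d2E'.
Qed.

End Transversality.

(** * Pairs of planes in R^4 *)

Section Frames.
Context {R : realType}.

Definition det2 (x y : 'rV[R]_2) : R := x 0 0 * y 0 1 - x 0 1 * y 0 0.

Lemma mul_row2 (x : 'rV[R]_2) (A : 'M[R]_(2, 4)) :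
  x *m A = x 0 0 *: row 0 A + x 0 1 *: row 1 A.
Proof.
rewrite mulmx_sum_row !big_ord_recl big_ord0 addr0.
by have -> : lift ord0 ord0 = 1 :> 'I_2 by apply/val_inj.
Qed.

Lemma wedge_mul_row2 (x y : 'rV[R]_2) (A : 'M[R]_(2, 4)) :
  wedge (x *m A) (y *m A) = det2 x y *: wedge (row 0 A) (row 1 A).
Proof.
rewrite !mul_row2 !wedge_addl !wedge_addr !wedge_scalel !wedge_scaler !wedge_self.
rewrite (wedgeC (row 1 A)) !scaler0 add0r addr0 scalerN scalerN !scalerA -scalerBl.
by rewrite /det2.
Qed.

Lemma det2_basis (x y k : 'rV[R]_2) : det2 x y != 0 -> exists s t, k = s *: x + t *: y.
Proof.
move=> D0; exists (det2 k y / det2 x y), (det2 x k / det2 x y).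
have H : det2 x y *: k = det2 k y *: x + det2 x k *: y.
  apply/rowP => i; rewrite !mxE /det2.
  have : i = 0 \/ i = 1 by case: i => [[|[|]]] // ?; [left|right]; apply/val_inj.
  by case=> ->; ring.
by rewrite !(mulrC _ (_^-1)) -!scalerA -scalerDr -H scalerA mulVf // scale1r.
Qed.

Lemma row_free_wedge (A : 'M[R]_(2, 4)) : row_free A -> wedge (row 0 A) (row 1 A) != 0.
Proof.
move=> fA; apply/eqP => w0.
have A00 : row 0 A = 0.
  apply: co_rowP => i i4; rewrite co0.
  have := wedge_eq0 w0 i4.
  pose v : 'rV[R]_2 := \row_j (if j == 0 then - co i (row 1 A) else co i (row 0 A)).
  have vA : v *m A = - co i (row 1 A) *: row 0 A + co i (row 0 A) *: row 1 A.
    by rewrite mul_row2 !mxE.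
  move=> E; have : v *m A = 0 by rewrite vA E scaleNr addNr.
  move/eqP; rewrite mulmx_free_eq0 // => /eqP/rowP/(_ 1).
  by rewrite !mxE.
have : delta_mx 0 0 *m A = 0 :> 'rV[R]_4 by rewrite -rowE.
by move/eqP; rewrite mulmx_free_eq0 // => /eqP/rowP/(_ 0)/eqP; rewrite !mxE !eqxx oner_eq0.
Qed.

Lemma transversal_complement (e u v : 'rV[R]_4) : wedge e u != 0 ->
  ~ (exists x y, v = x *: e + y *: u) -> exists y, vol e u v y != 0.
Proof.
move=> eu nv; apply: contrapT => H; apply: nv; apply: span2_of_vol => // z.
by apply: contrapT => /eqP vz; apply: H; exists z.
Qed.

(** Frames e, u of A and e, v of B with the same first vector; u and v are
    obtained from e by a quarter turn of its coordinates, which makes the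
    coordinate frames invertible. *)
Lemma line_intersection (A B : 'M[R]_(2, 4)) : row_free A -> row_free B ->
  \rank (A :&: B)%MS = 1 ->
  exists a a' b b' y, [/\ a *m A = b *m B,
    vol (a *m A) (a' *m A) (b' *m B) y != 0, det2 a a' != 0 & det2 b b' != 0].
Proof.
move=> fA fB r1.
have /rowV0Pn[e eAB e0] : (A :&: B)%MS != 0 by rewrite -mxrank_eq0 r1.
have := eAB; rewrite sub_capmx => /andP[/submxP[a ea] /submxP[b eb]].
(* The determinant of x and rot x is the squared norm of x. *)
pose rot (x : 'rV[R]_2) : 'rV[R]_2 := \row_j (if j == 0 then - x 0 1 else x 0 0).
have rot0 (x : 'rV[R]_2) : x != 0 -> det2 x (rot x) != 0.
  move=> x0; rewrite /det2 !mxE /= mulrN opprK; apply: contraNneq x0 => /eqP.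
  rewrite paddr_eq0 -?expr2 ?sqr_ge0 // !sqrf_eq0 => /andP[/eqP x00 /eqP x01].
  apply/eqP/rowP => i; rewrite mxE.
  have : i = 0 \/ i = 1 by case: i => [[|[|]]] // ?; [left|right]; apply/val_inj.
  by case=> ->.
have a0 : a != 0 by apply: contraNneq e0 => a0; rewrite ea a0 mul0mx.
have b0 : b != 0 by apply: contraNneq e0 => b0; rewrite eb b0 mul0mx.
have da := rot0 _ a0; have db := rot0 _ b0.
have wa : wedge e (rot a *m A) != 0.
  by rewrite {1}ea wedge_mul_row2 scaler_eq0 negb_or da row_free_wedge.
have wb : wedge e (rot b *m B) != 0.
  by rewrite {1}eb wedge_mul_row2 scaler_eq0 negb_or db row_free_wedge.
have [|y vy] := transversal_complement wa (v := rot b *m B).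
  move=> [s [t E]].
  have vAB : (rot b *m B <= A :&: B)%MS.
    rewrite sub_capmx submxMl andbT E ea; apply: addmx_sub; apply: scalemx_sub; exact: submxMl.
  have : (A :&: B <= e)%MS.
    by rewrite -(geq_leqif (mxrank_leqif_sup eAB)) r1 rank_rV e0.
  move/(submx_trans vAB)/sub_rVP => [c cE].
  by move/eqP: wb; apply; rewrite cE wedge_scaler wedge_self scaler0.
exists a, (rot a), b, (rot b), y; split => //; rewrite -?ea -?eb //.
Qed.

Lemma plane_intersection (A B : 'M[R]_(2, 4)) : row_free A ->
  \rank (A :&: B)%MS = 2 -> exists b b', row 0 A = b *m B /\ row 1 A = b' *m B.
Proof.
move=> fA r2.
have AB : (A <= B)%MS.
  have /submx_trans : (A <= A :&: B)%MS.
    by rewrite -(geq_leqif (mxrank_leqif_sup (capmxSl A B))) r2 rank_leq_row.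
  by apply; exact: capmxSr.
have r i : (row i A <= B)%MS := submx_trans (row_sub i A) AB.
by have /submxP[b ->] := r 0; have /submxP[b' ->] := r 1; exists b, b'.
Qed.
End Frames.

(** * The second derivative of a combination of two surfaces *)

Section Germs.
Context {R : realType}.

Lemma derive_lin2 n m (X : 'rV[R]_n -> 'rV[R]_m) p (a a' : 'rV[R]_n) s t :
  differentiable X p -> 'D_(s *: a + t *: a') X p = s *: 'D_a X p + t *: 'D_a' X p.
Proof. by move=> dX; rewrite !deriveE // linearD !linearZ. Qed.

Lemma derive2_lin2 n m (X : 'rV[R]_n -> 'rV[R]_m) p (a a' w : 'rV[R]_n) s t :
  smooth_at X p -> 'D_w ('D_(s *: a + t *: a') X) p =
    s *: 'D_w ('D_a X) p + t *: 'D_w ('D_a' X) p.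
Proof.
move=> sX.
have D b := derivableP (@diff_derivable _ _ _ _ _ w (smooth_at_differentiable [:: b] sX)).
have [_ <-] := is_deriveD (is_deriveZ s (D a)) (is_deriveZ t (D a')).
apply: near_eq_derive.
by apply: filterS (smooth_at_near [::] sX) => y dX; exact: derive_lin2.
Qed.

Lemma second_derivative_sum (X Y : 'rV[R]_2 -> 'rV[R]_4) (lam : R) :
  smooth_at X 0 -> smooth_at Y 0 ->
  let phi (z : 'rV[R]_2 * 'rV[R]_2) := lam *: X z.1 + (1 - lam) *: Y z.2 in
  (forall k, 'D_k phi (0, 0) = lam *: 'D_k.1 X 0 + (1 - lam) *: 'D_k.2 Y 0) /\
  (forall w k, 'D_w ('D_k phi) (0, 0) =
     lam *: 'D_w.1 ('D_k.1 X) 0 + (1 - lam) *: 'D_w.2 ('D_k.2 Y) 0).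
Proof.
move=> sX sY phi.
have D1 (X1 Y1 : 'rV[R]_2 -> 'rV[R]_4) (z k : 'rV[R]_2 * 'rV[R]_2) :
    differentiable X1 z.1 -> differentiable Y1 z.2 ->
    is_derive z k (fun z => lam *: X1 z.1 + (1 - lam) *: Y1 z.2)
      (lam *: 'D_k.1 X1 z.1 + (1 - lam) *: 'D_k.2 Y1 z.2).
  move=> dX dY; rewrite !deriveE //.
  exact: (is_deriveD
    (is_deriveZ lam (is_derive_comp_diff (differentiable_fst z) (is_derive_fst z k) dX))
    (is_deriveZ (1 - lam) (is_derive_comp_diff (differentiable_snd z) (is_derive_snd z k) dY))).
have near_phi k : \forall z \near ((0, 0) : 'rV[R]_2 * 'rV[R]_2),
    'D_k phi z = lam *: 'D_k.1 X z.1 + (1 - lam) *: 'D_k.2 Y z.2.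
  have nX : \forall z \near ((0, 0) : 'rV[R]_2 * 'rV[R]_2), differentiable X z.1.
    have cfst : {for ((0, 0) : 'rV[R]_2 * 'rV[R]_2), continuous fst}.
      exact: (differentiable_continuous (differentiable_fst _)).
    exact: (cfst _ (smooth_at_near [::] sX)).
  have nY : \forall z \near ((0, 0) : 'rV[R]_2 * 'rV[R]_2), differentiable Y z.2.
    have csnd : {for ((0, 0) : 'rV[R]_2 * 'rV[R]_2), continuous snd}.
      exact: (differentiable_continuous (differentiable_snd _)).
    exact: (csnd _ (smooth_at_near [::] sY)).
  near=> z; have dX : differentiable X z.1 by near: z.
  have dY : differentiable Y z.2 by near: z.
  by have [_ ->] := D1 X Y z k dX dY.
split=> [k|w k]; first exact: nbhs_singleton (near_phi k).
rewrite (near_eq_derive _ (near_phi k)).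
have [_ ->] := D1 ('D_k.1 X) ('D_k.2 Y) (0, 0) w (smooth_at_differentiable [:: k.1] sX)
  (smooth_at_differentiable [:: k.2] sY).
by [].
Unshelve. all: by end_near. Qed.

(** Membership in the second kernel for the local form of Psi, once the
    tangent planes are given frames (e, u) and (f, v) that are the derivatives
    along (a, a') and (b, b'): a statement about vectors of R^4 only. *)
Lemma second_kernel_sum (X Y : 'rV[R]_2 -> 'rV[R]_4) (lam : R)
    (a a' b b' x y : 'rV[R]_2)
    (e u f v e1 u1 f1 v1 : 'rV[R]_4) :
  lam != 0 -> 1 - lam != 0 -> smooth_at X 0 -> smooth_at Y 0 ->
  det2 a a' != 0 -> det2 b b' != 0 ->
  'D_a X 0 = e -> 'D_a' X 0 = u -> 'D_b Y 0 = f -> 'D_b' Y 0 = v ->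
  'D_x ('D_a X) 0 = e1 -> 'D_x ('D_a' X) 0 = u1 ->
  'D_y ('D_b Y) 0 = f1 -> 'D_y ('D_b' Y) 0 = v1 ->
  (forall s s' t t',
     lam *: (s *: e + s' *: u) + (1 - lam) *: (t *: f + t' *: v) = 0 ->
     exists q q' r r',
       lam *: (s *: e1 + s' *: u1) + (1 - lam) *: (t *: f1 + t' *: v1) =
       (q *: e + q' *: u) + (r *: f + r' *: v)) ->
  in_second_kernel
    (fun z : 'rV[R]_2 * 'rV[R]_2 => lam *: X z.1 + (1 - lam) *: Y z.2) (0, 0) (x, y).
Proof.
move=> l0 l1 sX sY da db eE uE fE vE e1E u1E f1E v1E H k.
have [D1 D2] := second_derivative_sum lam sX sY.
have dX : differentiable X 0 := smooth_at_differentiable [::] sX.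
have dY : differentiable Y 0 := smooth_at_differentiable [::] sY.
have LX s s' : 'D_(s *: a + s' *: a') X 0 = s *: e + s' *: u.
  by rewrite (derive_lin2 a a' s s' dX) eE uE.
have LY t t' : 'D_(t *: b + t' *: b') Y 0 = t *: f + t' *: v.
  by rewrite (derive_lin2 b b' t t' dY) fE vE.
rewrite D1 D2; have [s [s' ->]] := det2_basis k.1 da; have [t [t' ->]] := det2_basis k.2 db.
rewrite LX LY (derive2_lin2 a a' x s s' sX) (derive2_lin2 b b' y t t' sY) e1E u1E f1E v1E.
move=> /H[q [q' [r [r' ->]]]].
exists ((lam^-1 * q) *: a + (lam^-1 * q') *: a',
  ((1 - lam)^-1 * r) *: b + ((1 - lam)^-1 * r') *: b').
rewrite D1 /= LX LY !scalerDr !scalerA.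
by rewrite !mulrA !mulfV // !mul1r.
Qed.

(** Normalizing a coordinate changes the differential only by a factor and a
    multiple of the base vector. *)
Lemma diff_normalized (E : normedModType R) (P : E -> 'rV[R]_6) z k :
  differentiable P z -> P z 0 k != 0 ->
  differentiable (fun y => (P y 0 k)^-1 *: P y) z /\
  forall w, exists s, 'd P z w = s *: P z + P z 0 k *: 'd (fun y => (P y 0 k)^-1 *: P y) z w.
Proof.
move=> dP Pk; set g := fun y => _.
have dPk := differentiable_rowcoord k dP.
have dg : differentiable g z.
  apply: differentiable_rowP => j.
  have -> : (fun y => g y 0 j) = (fun y => (P y 0 k)^-1) * (fun y => P y 0 j).
    by apply/funext => y; rewrite /g mxE.
  by apply: differentiableM; [exact: differentiableV | exact: differentiable_rowcoord].
split=> // w; exists ('d (fun y => P y 0 k) z w * (P z 0 k)^-1).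
have near_P : \forall y \near z, P y = P y 0 k *: g y.
  apply: filterS (near_neq0 dPk Pk) => y Pyk.
  by rewrite /g scalerA mulfV // scale1r.
transitivity ('D_w P z); first exact: (esym (deriveE w dP)).
transitivity ('D_w (fun y => P y 0 k *: g y) z); first exact: near_eq_derive near_P.
have [_ DE] := is_derive_scale (is_derive_diff w dPk) (is_derive_diff w dg).
by apply: (etrans DE); rewrite -scalerA.
Qed.
End Germs.

(** * The Gauss map in a chart *)

Section GaussFrame.
Context {R : realType} {M : closedSurface R}.
Implicit Types (f : M -> 'rV[R]_4) (a b c : M).

Lemma smooth_at_par f a : embedding f -> smooth_at (f \o par a) 0.
Proof.
by move=> [sf _ _ _]; exists (pdom a); split; [exact: pdom_open | exact: pdom0 | exact: sf].
Qed.

Lemma derive_tangent_plane f a (x : 'rV[R]_2) : embedding f ->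
  'D_x (f \o par a) 0 = x *m tangent_plane f a.
Proof.
move=> ef; rewrite deriveEjacobian //.
exact: (smooth_at_differentiable [::] (smooth_at_par a ef)).
Qed.

(** At points other than the centre, the tangent plane is defined by another
    parametrization; the transition map only multiplies the wedge of a frame by a
    determinant, which the projective class ignores. *)
Lemma Gauss_frame f a x (al be : 'rV[R]_2) : embedding f -> pdom a x ->
  wedge ('D_al (f \o par a) x) ('D_be (f \o par a) x) != 0 ->
  Gauss f (par a x) = pclass (wedge ('D_al (f \o par a) x) ('D_be (f \o par a) x)).
Proof.
move=> ef ax; have [sf _ _ _] := ef.
set c := par a x.
have oc : (par c @` pdom c) c by exists 0; [exact: pdom0 | exact: par0].
pose O := pdom a `&` par a @^-1` (par c @` pdom c).
have Ox : O x by split.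
have tau0 : (coord c \o par a) x = 0 by rewrite /= -/c -{2}(par0 c) parK //; exact: pdom0.
have dtau : differentiable (coord c \o par a) x.
  exact: (smooth_on_differentiable (@transition_smooth R M a c) Ox).
have dfc : differentiable (f \o par c) ((coord c \o par a) x).
  by rewrite tau0; exact: (smooth_at_differentiable [::] (smooth_at_par c ef)).
have near_tau : \forall y \near x, (f \o par a) y = ((f \o par c) \o (coord c \o par a)) y.
  have cont : {for x, continuous (par a)} by exact: par_continuous.
  have : \forall y \near x, (par c @` pdom c) (par a y).
    by apply: cont; apply: open_nbhs_nbhs; split; [exact: par_open|].
  by apply: filterS => y [t ct E] /=; rewrite -E parK.
have Da v : 'D_v (f \o par a) x = 'd (coord c \o par a) x v *m tangent_plane f c.
  rewrite (near_eq_derive _ near_tau).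
  have [_ ->] := is_derive_comp_diff dtau (is_derive_diff v dtau) dfc.
  by rewrite tau0 -derive_tangent_plane // deriveE // -tau0.
rewrite !Da wedge_mul_row2 => H; rewrite pclassZ //.
by apply: contraNneq H => ->; rewrite scale0r.
Qed.

Lemma Gauss_local_near f a (al be : 'rV[R]_2) (k : 'I_6) : embedding f ->
  let P x := wedge ('D_al (f \o par a) x) ('D_be (f \o par a) x) in
  P 0 0 k != 0 -> \forall x \near (0 : 'rV[R]_2),
    P x 0 k != 0 /\ Gauss_local f a x = pclass (P x).
Proof.
move=> ef P Pk.
have sX := smooth_at_par a ef.
have dP : differentiable P 0.
  apply: differentiable_wedge; first exact: (smooth_at_differentiable [:: al] sX).
  exact: (smooth_at_differentiable [:: be] sX).
near=> x; have Pxk : P x 0 k != 0.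
  by near: x; exact: near_neq0 (differentiable_rowcoord k dP) Pk.
split=> //; apply: Gauss_frame => //.
  by near: x; apply: open_nbhs_nbhs; split; [exact: pdom_open|exact: pdom0].
by apply: contraNneq Pxk => H; rewrite /P H mxE.
Unshelve. all: by end_near. Qed.

(** The differential of the Gauss map expressed by the second derivatives of the
    parametrization, modulo the line of [wedge e u]. *)
Lemma Gauss_chart f a (al be : 'rV[R]_2) (k : 'I_6) : embedding f ->
  let e := 'D_al (f \o par a) 0 in let u := 'D_be (f \o par a) 0 in
  let Ga := chart k \o Gauss_local f a in
  wedge e u 0 k != 0 ->
  [/\ Gauss f a = pclass (wedge e u), differentiable Ga 0,
      \forall x \near (0 : 'rV[R]_2), in_chart k Gr24 (Ga x) &
      forall w, exists s,
        wedge ('D_w ('D_al (f \o par a)) 0) u + wedge e ('D_w ('D_be (f \o par a)) 0) =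
        s *: wedge e u + wedge e u 0 k *: 'd Ga 0 w].
Proof.
move=> ef e u Ga ek.
have sX := smooth_at_par a ef.
have dal := smooth_at_differentiable [:: al] sX.
have dbe := smooth_at_differentiable [:: be] sX.
pose P x := wedge ('D_al (f \o par a) x) ('D_be (f \o par a) x).
have dP : differentiable P 0 by exact: differentiable_wedge dal dbe.
have nG := Gauss_local_near ef ek.
have [dg dgE] := diff_normalized dP ek.
have nGa : \forall x \near (0 : 'rV[R]_2), (P x 0 k)^-1 *: P x = Ga x.
  by apply: filterS nG => x [Pk GP]; rewrite /Ga /= GP chart_pclass.
split.
- by have [_] := nbhs_singleton nG; rewrite /Gauss_local par0.
- exact: near_eq_differentiable nGa dg.
- apply: filterS nG => x [Pk GP]; exists (Gauss_local f a x) => //.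
  rewrite GP; split; last exact/chart_domE.
  exists (P x) => //; split; last by exists ('D_al (f \o par a) x), ('D_be (f \o par a) x).
  by apply/eqP => H; move: Pk; rewrite (_ : wedge _ _ = 0) ?mxE ?eqxx.
- move=> w; have [s sE] := dgE w; exists s.
  rewrite -(near_eq_diff nGa dg) -sE.
  have [_ E] := is_derive_wedge (is_derive_diff w dal) (is_derive_diff w dbe).
  rewrite (deriveE w dal) (deriveE w dbe); apply: (etrans (esym E)); exact: (deriveE w dP).
Qed.
End GaussFrame.

(** * Linear algebra of a parallel pair *)

Section Assembly.
Context {R : realType}.

Lemma vol_swap23 (a b c d : 'rV[R]_4) : vol a b c d = - vol a c b d.
Proof. rewrite /vol !wedge2E !wedgeE !bi_row //=; ring. Qed.

Lemma wedge0l (u : 'rV[R]_4) : wedge 0 u = 0.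
Proof. by rewrite -(scale0r 0) wedge_scalel scale0r. Qed.

Lemma wedge20l (q : 'rV[R]_6) : wedge2 0 q = 0.
Proof. by rewrite -(scale0r 0) wedge2_scalel mul0r. Qed.

Lemma vol_independent (e u v y : 'rV[R]_4) r s t : vol e u v y != 0 ->
  r *: e + s *: u + t *: v = 0 -> [/\ r = 0, s = 0 & t = 0].
Proof.
move=> D0 Z.
have rE : wedge2 (wedge (r *: e + s *: u + t *: v) u) (wedge v y) = r * vol e u v y.
  rewrite /vol !wedge2E !wedgeE !bi_row //= !coE; ring.
have sE : wedge2 (wedge e (r *: e + s *: u + t *: v)) (wedge v y) = s * vol e u v y.
  rewrite /vol !wedge2E !wedgeE !bi_row //= !coE; ring.
have tE : wedge2 (wedge e u) (wedge (r *: e + s *: u + t *: v) y) = t * vol e u v y.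
  rewrite /vol !wedge2E !wedgeE !bi_row //= !coE; ring.
have z c : 0 = c * vol e u v y -> c = 0.
  by move=> /esym/eqP; rewrite mulf_eq0 (negbTE D0) orbF => /eqP.
split; apply: z; [rewrite -rE|rewrite -sE|rewrite -tE]; rewrite Z.
- by rewrite wedge0l wedge20l.
- by rewrite wedgeC wedge0l oppr0 wedge20l.
- by rewrite wedge2C wedge0l wedge20l.
Qed.

Lemma wedge_independent (e u : 'rV[R]_4) r s : wedge e u != 0 ->
  r *: e + s *: u = 0 -> r = 0 /\ s = 0.
Proof.
move=> /wedge2_nondegenerate_neq[v [y D0]] Z.
by have [] := @vol_independent e u v y r s 0 D0 _; rewrite // Z scale0r addr0.
Qed.

(** If the plane of a moving frame e, u is stationary to first order, then the
    velocities of e and u stay in the plane. *)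
Lemma plane_of_stationary_frame (e u g h : 'rV[R]_4) c : wedge e u != 0 ->
  wedge g u + wedge e h = c *: wedge e u ->
  (exists r s, g = r *: e + s *: u) /\ (exists r s, h = r *: e + s *: u).
Proof.
move=> eu E; split; apply: span2_of_vol => // z.
  have := congr1 (fun x => wedge2 x (wedge e z)) E.
  rewrite /= wedge2_addl wedge2_scalel wedge2_abac addr0.
  have -> : wedge2 (wedge e u) (wedge e z) = 0 := wedge2_abac e u z.
  by rewrite mulr0 wedge2_swap_ac => /eqP; rewrite oppr_eq0 => /eqP.
have := congr1 (fun x => wedge2 x (wedge u z)) E.
rewrite /= wedge2_addl wedge2_scalel !wedge2_abbc mulr0 add0r => H.
by rewrite vol_swap23 /vol H oppr0.
Qed.

Lemma wedge_frame_sum (e u e1 u1 e2 u2 : 'rV[R]_4) (x y : 'rV[R]_6) s t c :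
  wedge e1 u + wedge e u1 = s *: wedge e u + c *: x ->
  wedge e2 u + wedge e u2 = t *: wedge e u + c *: y ->
  x + y = 0 -> wedge (e1 + e2) u + wedge e (u1 + u2) = (s + t) *: wedge e u.
Proof.
move=> E1 E2 xy.
by rewrite wedge_addl wedge_addr addrACA E1 E2 addrACA -scalerDr xy scaler0 addr0 scalerDl.
Qed.

(** For a 2-parallel pair a kernel vector has opposite components on the two
    sides, so only the sums of the velocities enter. *)
Lemma combination_in_common_plane (e u e1 u1 e2 u2 : 'rV[R]_4) (lam r t r' t' x x' y y' : R) :
  wedge e u != 0 -> e1 + e2 = r *: e + t *: u -> u1 + u2 = r' *: e + t' *: u ->
  lam *: (x *: e + x' *: u) + (1 - lam) *: (y *: e + y' *: u) = 0 ->
  exists q q' s s',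
    lam *: (x *: e1 + x' *: u1) + (1 - lam) *: (y *: (- e2) + y' *: (- u2)) =
    (q *: e + q' *: u) + (s *: e + s' *: u).
Proof.
move=> eu E1 E2; rewrite !scalerDr !scalerA addrACA -!scalerDl => /(wedge_independent eu)[F0 F1].
have {}F0 : (1 - lam) * y = - (lam * x) by apply/eqP; rewrite -addr_eq0 addrC F0.
have {}F1 : (1 - lam) * y' = - (lam * x') by apply/eqP; rewrite -addr_eq0 addrC F1.
exists (lam * x * r + lam * x' * r'), (lam * x * t + lam * x' * t'), 0, 0.
rewrite F0 F1 !scaleNr !scalerN !opprK addrACA -!scalerDr E1 E2.
by rewrite !scale0r !addr0 !scalerDr !scalerA addrACA -!scalerDl.
Qed.

Lemma injective_of_sum (La Lb : {linear 'rV[R]_2 -> 'rV[R]_6}) :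
  (forall x y, La x + Lb y = 0 -> x = 0 /\ y = 0) -> injective La /\ injective Lb.
Proof.
move=> inj; split=> x y xy; apply/eqP; rewrite -subr_eq0; apply/eqP.
  by have [] := inj (x - y) 0; rewrite ?linearB ?xy ?subrr ?linear0 ?addr0.
by have [] := inj 0 (x - y); rewrite ?linearB ?xy ?subrr ?linear0 ?addr0.
Qed.

(** A count of dimensions: La and Lb together have rank 4, and the tangent space
    is the kernel of two independent linear equations on R^6. *)
Lemma tangent_space_sum (La Lb : {linear 'rV[R]_2 -> 'rV[R]_6}) (p : 'rV[R]_6) (k : 'I_6) :
  p 0 k = 1 -> wedge2 p p = 0 ->
  (forall x y, La x + Lb y = 0 -> x = 0 /\ y = 0) ->
  (forall x, La x 0 k = 0 /\ wedge2 p (La x) = 0) ->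
  (forall x, Lb x 0 k = 0 /\ wedge2 p (Lb x) = 0) ->
  forall v : 'rV[R]_6, v 0 k = 0 -> wedge2 p v = 0 -> exists x y, v = La x + Lb y.
Proof.
move=> pk pp inj Ta Tb v vk pv.
pose S := col_mx (lin1_mx La) (lin1_mx Lb) : 'M[R]_(2 + 2, 6).
have SE (z : 'rV[R]_(2 + 2)) : z *m S = La (lsubmx z) + Lb (rsubmx z).
  by rewrite -{1}[z]hsubmxK mul_row_col !mul_rV_lin1.
pose eqs (x : 'rV[R]_6) := row_of_seq 2 [:: x 0 k; wedge2 p x].
have lin_eqs : linear eqs.
  move=> c x y; apply/rowP => -[[|[|]] i2] //;
    rewrite [RHS]mxE [(c *: eqs x) 0 _]mxE /eqs !row_of_seqE /=; first by rewrite !mxE.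
  by rewrite wedge2_addr wedge2_scaler.
pose Me := GRing.isLinear.Build _ _ _ _ _ lin_eqs.
pose Le : {linear 'rV[R]_6 -> 'rV[R]_2} := HB.pack eqs Me.
pose N := lin1_mx Le.
have NE x : x *m N = eqs x by rewrite mul_rV_lin1.
have eqs0 (x : 'rV[R]_6) : x 0 k = 0 -> wedge2 p x = 0 -> eqs x = 0.
  move=> xk px; apply/rowP => -[[|[|]] i2] //; rewrite row_of_seqE mxE /=; [exact: xk|exact: px].
have S_free : row_free S.
  apply: inj_row_free => z; rewrite SE => /inj[z1 z2].
  by rewrite -[z]hsubmxK z1 z2 row_mx0.
have N_full : row_full N.
  have [y1 [y2 sn0]] := wedge2_nondegenerate_neq (coord1_neq0 pk).
  rewrite -sub1mx; apply/row_subP => i; move: (row i _) => t; apply/submxP.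
  have [x px] : exists x, wedge2 p x = t 0 1.
    by exists ((t 0 1 / wedge2 p (wedge y1 y2)) *: wedge y1 y2); rewrite wedge2_scaler mulfVK.
  exists (x + (t 0 0 - x 0 k) *: p); rewrite NE; apply/rowP => -[[|[|]] i2] //; rewrite row_of_seqE /=.
    rewrite !mxE pk mulr1 addrC subrK; congr (t 0 _); exact/val_inj.
  rewrite wedge2_addr wedge2_scaler pp mulr0 addr0 px.
  congr (t 0 _); exact/val_inj.
have SN : (S <= kermx N)%MS.
  apply/sub_kermxP/row_matrixP => i; rewrite row0 row_mul NE.
  have -> : row i S = delta_mx 0 i *m S by rewrite -rowE.
  rewrite SE; have [a1 a2] := Ta (lsubmx (delta_mx 0 i)); have [b1 b2] := Tb (rsubmx (delta_mx 0 i)).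
  by apply: eqs0; [rewrite mxE a1 b1 addr0 | rewrite wedge2_addr a2 b2 addr0].
have NS : (kermx N <= S)%MS.
  rewrite -(geq_leqif (mxrank_leqif_sup SN)) mxrank_ker.
  by move/eqP: N_full => ->; move/eqP: S_free => ->.
have : (v <= kermx N)%MS by apply/sub_kermxP; rewrite NE eqs0.
move=> /submx_trans/(_ NS)/submxP[z ->]; rewrite SE.
by exists (lsubmx z), (rsubmx z).
Qed.
End Assembly.

(** * 2-parallel pairs *)

Section ParallelPairs.
Context {R : realType} {M : closedSurface R}.
Implicit Types (f : M -> 'rV[R]_4) (a b c : M).

(** The zero kernel of a normal form passes to every germ equivalent to it. *)
Lemma A_equiv_normal_form_kernel n (phi : 'rV[R]_2 * 'rV[R]_2 -> 'rV[R]_4)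
    (g : 'rV[R]_n -> 'rV[R]_4) :
  smooth_at phi (0, 0) -> smooth_at g 0 -> A_equiv phi (0, 0) g 0 ->
  (forall w, in_second_kernel g 0 w -> w = 0) ->
  forall w, in_second_kernel phi (0, 0) w -> w = (0, 0).
Proof.
move=> sphi sg /(A_equiv_second_kernel sphi sg)[L [bL L0 HL]] g0 w /HL/g0 Lw.
by apply: (bij_inj bL); rewrite Lw L0.
Qed.

(** The hypothesis on the second kernel is what the C_{2,2} normal forms
    provide. *)
Lemma two_parallel_pair f a b (lam : R) : embedding f -> lam != 0 -> 1 - lam != 0 -> a <> b ->
  \rank (tangent_plane f a :&: tangent_plane f b)%MS = 2 ->
  W_sing (Gauss f a, Gauss f b) /\
    ((forall w, in_second_kernel (Psi_local f lam a b) (0, 0) w -> w = (0, 0)) ->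
     transversal_double_point f a b).
Proof.
move=> ef l0 l1 ab r2; have [_ imm _ _] := ef.
have [be [be' [eB uB]]] := plane_intersection (imm a) r2.
pose al : 'rV[R]_2 := delta_mx 0 0; pose al' : 'rV[R]_2 := delta_mx 0 1.
have sX := smooth_at_par a ef; have sY := smooth_at_par b ef.
set X := f \o par a in sX; set Y := f \o par b in sY.
have DX v : 'D_v X 0 = v *m tangent_plane f a := derive_tangent_plane a v ef.
have DY v : 'D_v Y 0 = v *m tangent_plane f b := derive_tangent_plane b v ef.
have eX : 'D_al X 0 = row 0 (tangent_plane f a) by rewrite DX -rowE.
have uX : 'D_al' X 0 = row 1 (tangent_plane f a) by rewrite DX -rowE.
have eY : 'D_be Y 0 = row 0 (tangent_plane f a) by rewrite DY eB.
have uY : 'D_be' Y 0 = row 1 (tangent_plane f a) by rewrite DY uB.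
have eu := row_free_wedge (imm a).
set e := row 0 _ in eX eY eu eB *; set u := row 1 _ in uX uY eu uB *.
have da : det2 al al' != 0 by rewrite /det2 !mxE /= mulr0 subr0 mulr1 oner_neq0.
have db : det2 be be' != 0.
  by apply: contraNneq eu => d0; rewrite eB uB wedge_mul_row2 d0 scale0r.
have [k ek] : exists k, wedge e u 0 k != 0 by apply/rV0Pn.
have ekX : wedge ('D_al X 0) ('D_al' X 0) 0 k != 0 by rewrite eX uX.
have ekY : wedge ('D_be Y 0) ('D_be' Y 0) 0 k != 0 by rewrite eY uY.
have [GaE dGa nGa DGa] := Gauss_chart ef ekX.
have [GbE dGb nGb DGb] := Gauss_chart ef ekY.
rewrite -/X eX uX in GaE DGa; rewrite -/Y eY uY in GbE DGb.
have du : decomposable (wedge e u) by exists e, u.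
split.
  split.
    exists (wedge e u), (wedge e u).
    split; [exact: conj eu du | exact: conj eu du | | exact: wedge2_abab].
    by rewrite GaE GbE.
  by rewrite GaE GbE; exact: diagonal_not_W_reg eu du.
move=> ker0.
set Ga := chart k \o _ in dGa nGa DGa; set Gb := chart k \o _ in dGb nGb DGb.
have inj x y : 'd Ga 0 x + 'd Gb 0 y = 0 -> x = 0 /\ y = 0.
  move=> dxy; have [s sE] := DGa x; have [s' sE'] := DGb y.
  have := wedge_frame_sum sE sE' dxy.
  move=> /(plane_of_stationary_frame eu)[[r [t rt]] [r' [t' rt']]].
  have H : in_second_kernel (Psi_local f lam a b) (0, 0) (x, - y).
    have DN (b0 : 'rV[R]_2) : 'D_(- y) ('D_b0 Y) 0 = - 'D_y ('D_b0 Y) 0.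
      have dY := smooth_at_differentiable [:: b0] sY.
      exact: (etrans (deriveE (- y) dY)
        (etrans (linearN _ y) (congr1 -%R (esym (deriveE y dY))))).
    apply: (second_kernel_sum l0 l1 sX sY da db eX uX eY uY erefl erefl (DN be) (DN be')).
    by move=> x0 x1 y0 y1; exact: combination_in_common_plane eu rt rt'.
  have /pair_equal_spec[x0 y0] := ker0 _ H; split; first exact: x0.
  by rewrite -[y]opprK y0 oppr0.
have Ga0 : Ga 0 = (wedge e u 0 k)^-1 *: wedge e u.
  by rewrite /Ga /= /Gauss_local par0 GaE chart_pclass.
have Gb0 : Gb 0 = (wedge e u 0 k)^-1 *: wedge e u.
  by rewrite /Gb /= /Gauss_local par0 GbE chart_pclass.
set p := _ *: _ in Ga0 Gb0.
have pk : p 0 k = 1 by rewrite mxE mulVf.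
have pp : wedge2 p p = 0 by rewrite wedge2_scalel wedge2_scaler wedge2_abab !mulr0.
have Ta x : 'd Ga 0 x 0 k = 0 /\ wedge2 p ('d Ga 0 x) = 0.
  rewrite -Ga0; apply: Gr24_tangent (is_derive_diff x dGa) _.
  by apply: filterS nGa => y; exact: in_chart_Gr24.
have Tb x : 'd Gb 0 x 0 k = 0 /\ wedge2 p ('d Gb 0 x) = 0.
  rewrite -Gb0; apply: Gr24_tangent (is_derive_diff x dGb) _.
  by apply: filterS nGb => y; exact: in_chart_Gr24.
have [injA injB] := injective_of_sum inj.
have kdom : chart_dom k (Gauss f a) by rewrite GaE; exact: (chart_domE k (wedge e u)).2 ek.
split; [exact ab | exact (etrans GaE (esym GbE)) | exists k; cbv zeta; split].
- exact kdom.
- exact injA.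
- exact injB.
- move=> v [c [sc c0 nc <-]].
  have dc : differentiable c 0 := smooth_at_differentiable [::] sc.
  have c0p : c 0 = p by rewrite c0 GaE; exact: chart_pclass ek.
  have [] := Gr24_tangent (k := k) (is_derive_diff (1 : R) dc)
    (filterS (fun t => @in_chart_Gr24 R k (c t)) nc).
  rewrite c0p (derive1E' dc); exact: (tangent_space_sum pk pp inj Ta Tb).

Qed.
End ParallelPairs.

(** * 1-parallel pairs *)

Section OneParallel.
Context {R : realType}.

(** For a 1-parallel pair a kernel vector only has components along the common
    vector e, opposite on the two sides, so only the difference of the two
    velocities of e enters. *)
Lemma combination_in_tangent_span (e u v z e1 u1 e2 v1 : 'rV[R]_4) (lam r s t x x' y y' : R) :
  vol e u v z != 0 -> lam != 0 -> 1 - lam != 0 ->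
  e1 - e2 = r *: e + s *: u + t *: v ->
  lam *: (x *: e + x' *: u) + (1 - lam) *: (y *: e + y' *: v) = 0 ->
  exists q q' w w',
    lam *: (x *: e1 + x' *: u1) + (1 - lam) *: (y *: e2 + y' *: v1) =
    (q *: e + q' *: u) + (w *: e + w' *: v).
Proof.
move=> D0 l0 l1 E1 F.
have {}F : (lam * x + (1 - lam) * y) *: e + (lam * x') *: u + ((1 - lam) * y') *: v = 0.
  by rewrite -F !scalerDr !scalerA scalerDl !addrA; congr (_ + _); rewrite addrAC.
have [F0 /eqP F1 /eqP F2] := vol_independent D0 F.
move: F1 F2; rewrite !mulf_eq0 (negbTE l0) (negbTE l1) => /eqP -> /eqP ->.
have {}F0 : (1 - lam) * y = - (lam * x) by apply/eqP; rewrite -addr_eq0 addrC F0.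
exists (lam * x * r), (lam * x * s), 0, (lam * x * t).
rewrite !scale0r !addr0 add0r !scalerA F0 scaleNr -scalerBr E1 !scalerDr !scalerA.
by [].
Qed.

(** If the differential of the incidence form vanishes in a direction, then the
    two velocities of e differ by a vector of the span of the tangent planes. *)
Lemma tangent_incidence (e u v e1 u1 f1 v1 : 'rV[R]_4) (x z : 'rV[R]_6) s t c d :
  c != 0 -> d != 0 ->
  wedge e1 u + wedge e u1 = s *: wedge e u + c *: x ->
  wedge f1 v + wedge e v1 = t *: wedge e v + d *: z ->
  wedge2 x (wedge e (d^-1 *: v)) + wedge2 (wedge e (c^-1 *: u)) z = 0 ->
  vol e u v (e1 - f1) = 0.
Proof.
move=> c0 d0 E1 E2 H.
rewrite -(wedge2_tangent_pair e u v u1 v1) (addrC _ (wedge e1 u)) E1 (addrC _ (wedge f1 v)) E2.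
rewrite wedge2_addl wedge2_addr !wedge2_scalel !wedge2_scaler !wedge2_abac !mulr0 !add0r.
move: H; rewrite !wedge_scaler wedge2_scaler wedge2_scalel => /(congr1 (fun a => c * d * a)).
by rewrite mulr0 => <-; field; rewrite c0 d0.
Qed.

Context {M : closedSurface R}.
Implicit Types (f : M -> 'rV[R]_4) (a b c : M).

(** The hypothesis on the second kernel is what the A_k normal forms provide. *)
Lemma one_parallel_pair f a b (lam : R) : embedding f -> lam != 0 -> 1 - lam != 0 ->
  \rank (tangent_plane f a :&: tangent_plane f b)%MS = 1 ->
  W_reg (Gauss f a, Gauss f b) /\
    ((exists w, ~ in_second_kernel (Psi_local f lam a b) (0, 0) w) ->
     Gauss_transverse_Wreg f a b).
Proof.
move=> ef l0 l1 r1; have [_ imm _ _] := ef.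
have [al [al' [be [be' [y [eB evol da db]]]]]] := line_intersection (imm a) (imm b) r1.
have sX := smooth_at_par a ef; have sY := smooth_at_par b ef.
set X := f \o par a in sX; set Y := f \o par b in sY.
have DX v : 'D_v X 0 = v *m tangent_plane f a := derive_tangent_plane a v ef.
have DY v : 'D_v Y 0 = v *m tangent_plane f b := derive_tangent_plane b v ef.
have eX := DX al; have uX := DX al'; have eY := DY be; have vY := DY be'.
rewrite -eB in eY.
move: eX uX eY vY evol {eB DX DY}.
move: (al *m _) (al' *m _) (be' *m _) => e u v eX uX eY vY evol.
have p0 : wedge e u != 0.
  by apply: contraNneq evol => p0; rewrite /vol p0 wedge20l.
have q0 : wedge e v != 0.
  by apply: contraNneq evol => q0; rewrite vol_swap23 /vol q0 wedge20l oppr0.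
have [k pk] : exists k, wedge e u 0 k != 0 by apply/rV0Pn.
have [l ql] : exists l, wedge e v 0 l != 0 by apply/rV0Pn.
have pkX : wedge ('D_al X 0) ('D_al' X 0) 0 k != 0 by rewrite eX uX.
have qlY : wedge ('D_be Y 0) ('D_be' Y 0) 0 l != 0 by rewrite eY vY.
have [GaE dGa nGa DGa] := Gauss_chart ef pkX.
have [GbE dGb nGb DGb] := Gauss_chart ef qlY.
rewrite -/X eX uX in GaE DGa; rewrite -/Y eY vY in GbE DGb.
set c := wedge e u 0 k in pk DGa; set d := wedge e v 0 l in ql DGb.
have pE : wedge e (c^-1 *: u) = c^-1 *: wedge e u by rewrite wedge_scaler.
have qE : wedge e (d^-1 *: v) = d^-1 *: wedge e v by rewrite wedge_scaler.
have pk1 : wedge e (c^-1 *: u) 0 k = 1 by rewrite pE mxE mulVf.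
have ql1 : wedge e (d^-1 *: v) 0 l = 1 by rewrite qE mxE mulVf.
have evol1 : vol e (c^-1 *: u) (d^-1 *: v) y != 0.
  rewrite /vol wedge_scaler wedge_scalel wedge2_scalel wedge2_scaler.
  by rewrite !mulf_neq0 // invr_neq0.
have GaE1 : Gauss f a = pclass (wedge e (c^-1 *: u)) by rewrite GaE pE pclassZ // invr_neq0.
have GbE1 : Gauss f b = pclass (wedge e (d^-1 *: v)) by rewrite GbE qE pclassZ // invr_neq0.
have reg : W_reg (Gauss f a, Gauss f b).
  rewrite GaE1 GbE1; apply: (W_reg_pair (r := wedge (d^-1 *: v) y) pk1 ql1).
  - by exists e, (c^-1 *: u).
  - by exists e, (d^-1 *: v).
  - exact: wedge2_abac.
  - exact: evol1.
  - exact: wedge2_abbc.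
split; first exact reg.
move=> [w0 nw0]; split; first exact reg.
have [dom ch] := chart2_pclass pk1 ql1.
exists k, l; split; first by rewrite GaE1 GbE1.
set Ga := chart k \o _ in dGa nGa DGa; set Gb := chart l \o _ in dGb nGb DGb.
pose G (z : 'rV[R]_2 * 'rV[R]_2) := (Ga z.1, Gb z.2).
have d1 : differentiable (Ga \o fst) ((0, 0) : 'rV[R]_2 * 'rV[R]_2).
  exact: (@differentiable_comp _ _ _ _ fst _ (0, 0) (differentiable_fst _) dGa).
have d2 : differentiable (Gb \o snd) ((0, 0) : 'rV[R]_2 * 'rV[R]_2).
  exact: (@differentiable_comp _ _ _ _ snd _ (0, 0) (differentiable_snd _) dGb).
have dG : differentiable G (0, 0) := differentiable_pair d1 d2.
have DG w : 'd G (0, 0) w = ('d Ga 0 w.1, 'd Gb 0 w.2).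
  have [_ E] := is_derive_pair d1 d2
    (is_derive_comp_diff (differentiable_fst _) (is_derive_fst (0, 0) w) dGa)
    (is_derive_comp_diff (differentiable_snd _) (is_derive_snd (0, 0) w) dGb).
  exact: etrans (esym (deriveE w dG)) E.
have G0 : G (0, 0) = (wedge e (c^-1 *: u), wedge e (d^-1 *: v)).
  rewrite /G /Ga /Gb /= /Gauss_local !par0 -ch /chart2 /=.
  by rewrite -GaE1 -GbE1.
have nG : \forall z \near ((0, 0) : 'rV[R]_2 * 'rV[R]_2), in_chart2 k l (Gr24 `*` Gr24) (G z).
  have c1 : {for ((0, 0) : 'rV[R]_2 * 'rV[R]_2), continuous fst}.
    exact: (differentiable_continuous (differentiable_fst _)).
  have c2 : {for ((0, 0) : 'rV[R]_2 * 'rV[R]_2), continuous snd}.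
    exact: (differentiable_continuous (differentiable_snd _)).
  have n1 : \forall z \near ((0, 0) : 'rV[R]_2 * 'rV[R]_2), in_chart k Gr24 (Ga z.1).
    exact: (c1 _ nGa).
  have n2 : \forall z \near ((0, 0) : 'rV[R]_2 * 'rV[R]_2), in_chart l Gr24 (Gb z.2).
    exact: (c2 _ nGb).
  apply: filterS2 n1 n2 => z [C [GC dC] CE] [D [GD dD] DE].
  by exists (C, D); [split|rewrite /chart2 /= CE DE].
have [w om] : exists w, wedge2 ('d G (0, 0) w).1 (wedge e (d^-1 *: v))
    + wedge2 (wedge e (c^-1 *: u)) ('d G (0, 0) w).2 != 0.
  apply: contrapT => om; apply: nw0; case: w0 => x z.
  have om0 : wedge2 ('d Ga 0 x) (wedge e (d^-1 *: v))
      + wedge2 (wedge e (c^-1 *: u)) ('d Gb 0 z) = 0.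
    by apply: contrapT => /eqP n0; apply: om; exists (x, z); rewrite DG.
  have [s sE] := DGa x; have [t tE] := DGb z.
  have [r1' [r2 [r3 E]]] := span3_of_vol evol (tangent_incidence pk ql sE tE om0).
  apply: (second_kernel_sum l0 l1 sX sY da db eX uX eY vY erefl erefl erefl erefl).
  by move=> x0 x1 y0 y1; exact: combination_in_tangent_span evol l0 l1 E.
exact: (transverse_to_W_reg dG G0 pk1 ql1 evol1 nG om).
Qed.
End OneParallel.

(** * The theorem *)

Theorem theorem5p3 (R : realType) (M : closedSurface R) (lam : R)
    (f : M -> 'rV[R]_4) (a b : M)
    (hlam0 : lam != 0) (hlam1 : lam != 1)
    (hf : generic_embedding lam f)
    (hab : weakly_parallel f a b) :
  (k_parallel 1 f a b ->
    W_reg (Gauss f a, Gauss f b) /\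
    (stable_singularity_A (Psi_local f lam a b) (0, 0) ->
     Gauss_transverse_Wreg f a b))
  /\
  (k_parallel 2 f a b ->
    W_sing (Gauss f a, Gauss f b) /\
    (stable_singularity_C22 (Psi_local f lam a b) (0, 0) ->
     transversal_double_point f a b)).
Proof.
have l1 : 1 - lam != 0 by rewrite subr_eq0 eq_sym.
have ef : embedding f by have [S [[Semb _] _ Sf]] := hf; exact: Semb.
split=> [[_ r1]|[[ab _] r2]].
  have [reg tr] := one_parallel_pair ef hlam0 l1 r1; split; first exact reg.
  move=> [[sPsi _] [k k14 AE]]; apply: tr.
  have [L [[L' LK L'K] _ HL]] := A_equiv_second_kernel sPsi (smooth_normal_A 0 k14) AE.
  have [w nw] := second_kernel_normal_A_proper (R := R) k14.
  by exists (L' w) => /HL; rewrite L'K.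
have [sing dbl] := two_parallel_pair ef hlam0 l1 ab r2; split; first exact sing.
move=> [[sPsi _] CE]; apply: dbl.
case: CE => CE.
  exact: (A_equiv_normal_form_kernel sPsi (smooth_normal_C22p 0) CE (@second_kernel_normal_C22p R)).
exact: (A_equiv_normal_form_kernel sPsi (smooth_normal_C22m 0) CE (@second_kernel_normal_C22m R)).
Qed.
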